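(* Let $A,D\in F^\times$ be such that none of $A$, $D$, $AD$ is a square in $F^\times$, and let $r\in F^\times$. For $\operatorname{Re}(s)>1/2$ put $$I_s(r,A,D)=\int_{V^0}\left|x^2-r y^2-AD z^2+r D t^2\right|^{2(s-1)}\,dx\,dy\,dz\,dt .$$ Then the value at $s=0$ of the meromorphic continuation of $I_s(r,A,D)$ is $0$.
   Context: $F$ is a nonarchimedean local field of odd residual characteristic, $R$ its ring of integers, $\varpi$ a uniformizer, $q$ the cardinality of the residue field, $|\varpi|=q^{-1}$. $dx$ is the Haar measure on $F$ with $\int_R dx=1$, and $dx\,dy\,dz\,dt$ the product measure on $F^4$. Let $\mathcal V=\{(x,y,z,t)\in R^4:\max(|x|,|y|,|z|,|t|)=1\}$. For a function $\Phi$ on $\mathcal V$ invariant under $v\mapsto\alpha v$ for all $\alpha\in R^\times$, $\int_{V^0}\Phi(v)\,dv$ denotes $(1-q^{-1})^{-1}\int_{\mathcal V}\Phi(v)\,dv$. The integral converges for $\operatorname{Re}(s)>1/2$; ''value at $s=0$'' refers to its meromorphic continuation in $s$. *)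

(* Defs.v *)
From HB Require Import structures.
From mathcomp Require Import all_boot all_order all_algebra.
From mathcomp Require Import complex.
From mathcomp Require Import all_classical all_reals all_analysis.

Set Implicit Arguments.
Unset Strict Implicit.
Unset Printing Implicit Defensive.

Import Order.TTheory GRing.Theory Num.Theory.
Import numFieldNormedType.Exports.

Local Open Scope classical_set_scope.
Local Open Scope ring_scope.

Section LocalField.
Context {R : realType} {F : fieldType} (absF : F -> R).

Definition integer_ring : set F := [set x | absF x <= 1].
Definition maximal_ideal : set F := [set x | absF x < 1].

(* The residue field, as the set of cosets of the maximal ideal in the ring of
   integers; only its cardinality is needed. *)
Definition residue_cosets : set (set F) :=
  [set [set a + x | x in maximal_ideal] | a in integer_ring].

(* F is a nonarchimedean local field, complete for the discrete absolute value
   absF, with residue field of cardinality q; absF is normalized by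
   |uniformizer| = q^-1, a uniformizer being a generator of the maximal
   ideal. *)
Record local_field (q : nat) : Prop := LocalField {
  abs_ge0 : forall x, 0 <= absF x ;
  abs_eq0 : forall x, absF x = 0 <-> x = 0 ;
  absM : forall x y, absF (x * y) = absF x * absF y ;
  abs_ultrametric : forall x y, absF (x + y) <= Num.max (absF x) (absF y) ;
  abs_complete : forall u : nat -> F,
    (forall e : R, 0 < e -> exists N, forall m n : nat,
       (N <= m)%N -> (N <= n)%N -> absF (u m - u n) < e) ->
    exists l, forall e : R, 0 < e -> exists N, forall n : nat,
       (N <= n)%N -> absF (u n - l) < e ;
  abs_uniformizer : exists2 w : F,
    maximal_ideal = [set w * x | x in integer_ring] & absF w = q%:R^-1 ;
  residue_card : (residue_cosets #= `I_q)%card }.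

(* p is the characteristic of the residue field. *)
Definition residual_char (p : nat) : Prop := prime p /\ maximal_ideal p%:R.

End LocalField.

(* Stated for a zmodType because that is where the library's pointed structure,
   required by measurable spaces, is found. *)
Definition abs_open (R : realType) (F : zmodType) (absF : F -> R)
    (U : set F) : Prop :=
  forall x, U x -> exists2 e : R, 0 < e & forall y, absF (y - x) < e -> U y.

(* F as a measurable space, with its Borel sigma-algebra. *)
Notation borelF absF := (g_sigma_algebraType (abs_open absF)).

Definition is_normalized_haar (R : realType) (F : fieldType) (absF : F -> R)
    (mu : set (borelF absF) -> \bar R) : Prop :=
  (forall (a : F) (B : set (borelF absF)), measurable B ->
     mu [set a + x | x in (B : set F)] = mu B) /\
  mu (integer_ring absF) = 1%E.

Section Complex.
Context {R : realType}.

(* The regular module structure ^o is what carries the library's topology and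
   derivatives. *)
Local Notation C := (R[i]^o)%type.

Definition cexp (z : C) : C :=
  Complex (expR (complex.Re z) * cos (complex.Im z))
          (expR (complex.Re z) * sin (complex.Im z)).

(* a ^ w for a >= 0 and complex w; the value at a = 0 is a convention. *)
Definition cpow (a : R) (w : C) : C :=
  if a == 0 then 0 else cexp (w * (ln a)%:C%C).

Definition cintegral d (T : measurableType d) (mu : {measure set T -> \bar R})
    (B : set T) (f : T -> C) : C :=
  Complex (\int[mu]_(x in B) complex.Re (f x))%R
          (\int[mu]_(x in B) complex.Im (f x))%R.

Definition holomorphic_at (f : C -> C) (p : C) : Prop :=
  \forall z \near p, derivable f z 1.

(* Near p, f is a quotient of holomorphic functions whose denominator does not
   vanish identically (so has no zero in a punctured neighbourhood). *)
Definition meromorphic_at (f : C -> C) (p : C) : Prop :=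
  exists g h : C -> C, [/\ holomorphic_at g p, holomorphic_at h p &
    \forall z \near p^', h z != 0 /\ f z = g z / h z].

Definition meromorphic (f : C -> C) : Prop := forall p, meromorphic_at f p.

End Complex.

Section Integral.
Context {R : realType} {F : fieldType} (absF : F -> R) (q : nat).
Local Notation C := (R[i]^o)%type.
Local Notation X := (borelF absF).
Variable mu : {sigma_finite_measure set X -> \bar R}.

Definition unit_vectors : set (X * X * X * X) :=
  [set v | let: (x, y, z, t) := v in
     Num.max (Num.max (absF x) (absF y)) (Num.max (absF z) (absF t)) = 1].

Definition integral_V0 (Phi : X * X * X * X -> C) : C :=
  (1 - q%:R^-1)^-1 *
  cintegral (mu \x mu \x mu \x mu)%E unit_vectors Phi.

Definition quadric (r A D : F) (v : F * F * F * F) : F :=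
  let: (x, y, z, t) := v in
  x ^+ 2 - r * y ^+ 2 - A * D * z ^+ 2 + r * D * t ^+ 2.

Definition I_ (s : C) (r A D : F) : C :=
  integral_V0 (fun v => cpow (absF (quadric r A D v)) (2 * (s - 1))).

End Integral.

Definition is_square (F : fieldType) (a : F) : Prop := exists b : F, a = b ^+ 2.

(* Main.v *)
Require Import Defs.
From HB Require Import structures.
From mathcomp Require Import all_boot all_order all_algebra.
From mathcomp Require Import complex ring lra zify.
From mathcomp Require Import all_classical all_reals all_analysis measurable_realfun.

Set Implicit Arguments.
Unset Strict Implicit.
Unset Printing Implicit Defensive.

Import Order.TTheory GRing.Theory Num.Theory.
Import numFieldNormedType.Exports.

Local Open Scope classical_set_scope.
Local Open Scope ring_scope.

(** Write [Q] for the quadratic form and [vol] for the Haar measure of [F^4].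
    Near a nonzero vector the sets [|Q| <= q^-k] have volume [c q^-k] for large
    [k], so for a compact open [U] not containing [0] the integral of
    [|Q|^(2(s-1))] over [U] is a rational function of [T = q^(-2(s-1))] whose
    only pole is at [T = q]; its value at [T = q^2], that is at [s = 0], is a
    finitely additive function of [U] which is invariant under scaling, because
    [|Q|^-2 dv] is.  Hence for every lattice [L] it takes the same value on the
    fundamental domain [L \ w L].  As the discriminant [A] is not a square,
    [Q] is isotropic, and in suitable linear coordinates it is a multiple of
    [a b + z^2 - A t^2] with [A] a nonsquare unit or uniformizer; for the
    standard lattice in these coordinates three or four explicit regions
    contribute terms that cancel.  Only translation invariance and finite
    additivity of the volume on compact open sets enter. *)

(** * The absolute value and its value group *)

Section AbsoluteValue.
Context {R : realType} {F : fieldType} {absF : F -> R} {q : nat}.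
Hypothesis HF : local_field absF q.

(** The unit sphere of the maximum norm does not fit the normal form: the change of coordinates
    replaces the standard lattice by another one. As |Q|^(2(s-1)) dv has degree 4s, the freedom to
    change lattices exists at s = 0.

    The volume can stay abstract. Its pullback along a linear automorphism is again translation
    invariant and finitely additive, so no Jacobian is computed, and the volume of the unit box
    remains an unknown common factor of terms that cancel.

    Terms coming from a positive integrand can cancel because the value is a continuation: where Q
    has unit slope in some direction, a geometric series of ratio T / q is summed at T = q^2,
    outside its disc of convergence, and 1 / (1 - q) is negative. Multiplying by 1 - q / T
    beforehand makes every sum finite. The continuation thus becomes algebra of volumes, and
    analysis enters only when the integral is identified with the resulting rational function. *)

Lemma absF_ge0 x : 0 <= absF x. Proof. exact: abs_ge0 HF x. Qed.

Lemma absF0 : absF 0 = 0. Proof. exact/(abs_eq0 HF). Qed.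

Lemma absF_eq0 x : (absF x == 0) = (x == 0).
Proof. by apply/eqP/eqP => /(abs_eq0 HF). Qed.

Lemma absF_gt0 x : (0 < absF x) = (x != 0).
Proof. by rewrite lt_def absF_ge0 andbT absF_eq0. Qed.

Lemma absFM : {morph absF : x y / x * y}. Proof. exact: absM HF. Qed.

Lemma absF1 : absF 1 = 1.
Proof.
have n0 : absF 1 != 0 by rewrite absF_eq0 oner_eq0.
by apply: (mulfI n0); rewrite -absFM !mulr1.
Qed.

Lemma absFN x : absF (- x) = absF x.
Proof.
have sq1 : absF (-1) ^+ 2 = 1 by rewrite expr2 -absFM mulrNN mulr1 absF1.
have -> : - x = -1 * x by rewrite mulN1r.
suff e : absF (-1) = 1 by rewrite absFM e mul1r.
move/eqP: sq1; rewrite sqrf_eq1 => /orP[/eqP//|/eqP h].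
by have := absF_ge0 (-1); rewrite h; lra.
Qed.

Lemma absF_subC x y : absF (x - y) = absF (y - x).
Proof. by rewrite -absFN opprB. Qed.

Lemma absFX x n : absF (x ^+ n) = absF x ^+ n.
Proof. by elim: n => [|n IH]; rewrite ?expr0 ?absF1// !exprS absFM IH. Qed.

Lemma absFV x : absF x^-1 = (absF x)^-1.
Proof.
have [->|x0] := eqVneq x 0; first by rewrite invr0 absF0 invr0.
have n0 : absF x != 0 by rewrite absF_eq0.
by apply: (mulfI n0); rewrite -absFM !divff// absF1.
Qed.

Lemma absF_div x y : absF (x / y) = absF x / absF y.
Proof. by rewrite absFM absFV. Qed.

Lemma absF_mul_unit u x : absF u = 1 -> absF (u * x) = absF x.
Proof. by move=> u1; rewrite absFM u1 mul1r. Qed.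

Lemma absF_exprz x (k : int) : absF (x ^ k) = absF x ^ k.
Proof. by case: k => n; rewrite ?NegzE -?exprnN -?exprnP ?absFV absFX. Qed.

Lemma absF_add_le x y (c : R) : absF x <= c -> absF y <= c -> absF (x + y) <= c.
Proof.
by move=> xc yc; apply: le_trans (abs_ultrametric HF x y) _; rewrite ge_max xc.
Qed.

Lemma absF_add_lt x y (c : R) : absF x < c -> absF y < c -> absF (x + y) < c.
Proof.
by move=> xc yc; apply: le_lt_trans (abs_ultrametric HF x y) _; rewrite gt_max xc.
Qed.

Lemma absF_sub_le x y (c : R) : absF x <= c -> absF y <= c -> absF (x - y) <= c.
Proof. by move=> xc yc; apply: absF_add_le => //; rewrite absFN. Qed.

Lemma absF_sub_lt x y (c : R) : absF x < c -> absF y < c -> absF (x - y) < c.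
Proof. by move=> xc yc; apply: absF_add_lt => //; rewrite absFN. Qed.

Lemma absF_addr_lt x y : absF y < absF x -> absF (x + y) = absF x.
Proof.
move=> yx; apply/eqP; rewrite eq_le absF_add_le ?(ltW yx)//= leNgt.
apply/negP => h; have := absF_sub_lt h yx.
by rewrite addrK ltxx.
Qed.

Lemma absF_addl_lt x y : absF x < absF y -> absF (x + y) = absF y.
Proof. by rewrite addrC; exact: absF_addr_lt. Qed.

Lemma absF_close x y (c : R) : absF (x - y) < c -> c <= absF y -> absF x = absF y.
Proof.
by move=> h1 h2; rewrite -(subrK y x) absF_addl_lt// (lt_le_trans h1 h2).
Qed.

Lemma absF_nat_le1 n : absF n%:R <= 1.
Proof.
elim: n => [|n IH]; first by rewrite absF0 ler01.
by rewrite -addn1 natrD absF_add_le ?absF1.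
Qed.

Lemma residue_gt1 : (1 < q)%N.
Proof.
have [f [f_fun f_inj _]] : exists f,
    set_bij (residue_cosets absF) `I_q f.
  by apply/card_set_bijP; exact: residue_card HF.
pose m := maximal_ideal absF; pose k a := [set a + x | x in m].
have Rk a : absF a <= 1 -> residue_cosets absF (k a) by move=> a1; exists a.
have m0 : m 0 by rewrite /m /maximal_ideal/= absF0 ltr01.
have k01 : k 0 <> k 1.
  move=> e; have : k 0 0 by exists 0 => //; rewrite addr0.
  rewrite e => -[x mx /eqP]; rewrite addrC addr_eq0 => /eqP xe.
  by move: mx; rewrite /m /maximal_ideal/= xe absFN absF1 ltxx.
have h0 : residue_cosets absF (k 0) by apply: Rk; rewrite absF0 ler01.
have h1 : residue_cosets absF (k 1) by apply: Rk; rewrite absF1.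
have i0 : (f (k 0%R) < q)%N := f_fun _ h0.
have i1 : (f (k 1%R) < q)%N := f_fun _ h1.
have ne : f (k 0) <> f (k 1).
  by move=> e; apply: k01; apply: f_inj => //; rewrite inE.
by lia.
Qed.

Lemma qR_gt1 : 1 < q%:R :> R. Proof. by rewrite ltr1n residue_gt1. Qed.

Lemma qR_gt0 : 0 < q%:R :> R. Proof. exact: lt_trans ltr01 qR_gt1. Qed.

Lemma qR_neq0 : q%:R != 0 :> R. Proof. by rewrite gt_eqF ?qR_gt0. Qed.

Lemma ler_qz (k l : int) : (q%:R ^ k <= q%:R ^ l :> R) = (k <= l).
Proof. exact: (ler_eXz2l qR_gt1). Qed.

Lemma ltr_qz (k l : int) : (q%:R ^ k < q%:R ^ l :> R) = (k < l).
Proof. exact: (ltr_eXz2l qR_gt1). Qed.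

Lemma qz_gt0 (k : int) : 0 < q%:R ^ k :> R.
Proof. exact: exprz_gt0 qR_gt0. Qed.

Lemma qz_neq0 (k : int) : q%:R ^ k != 0 :> R.
Proof. by rewrite gt_eqF// qz_gt0. Qed.

Lemma qzD (k l : int) : q%:R ^ (k + l) = q%:R ^ k * q%:R ^ l :> R.
Proof. by rewrite expfzDr// qR_neq0. Qed.

Lemma qz_inj (k l : int) : q%:R ^ k = q%:R ^ l :> R -> k = l.
Proof. by move=> e; apply/eqP; rewrite eq_le -!ler_qz e lexx. Qed.

Lemma qz_large (c : R) : exists n : nat, c <= q%:R ^ (n : int).
Proof.
exists (Num.truncn c).+1; rewrite -exprnP.
apply: le_trans (ltW (truncnS_gt c)) _.
have : ((Num.truncn c).+1 <= q ^ (Num.truncn c).+1)%N.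
  exact: ltnW (ltn_expl _ residue_gt1).
by rewrite -natrX ler_nat.
Qed.

Lemma uniformizerP : exists w : F, absF w = q%:R^-1 /\
  forall x, absF x < 1 -> absF x <= q%:R^-1.
Proof.
have [w mw aw] := abs_uniformizer HF; exists w; split => // x x1.
have : maximal_ideal absF x by [].
rewrite mw => -[y y1 <-]; rewrite absFM aw ger_pMr// invr_gt0 qR_gt0.
by [].
Qed.

Lemma absF_lt1_le x : absF x < 1 -> absF x <= q%:R^-1.
Proof. by have [w [_ h]] := uniformizerP; exact: h. Qed.

Lemma exprz_uniformizer : exists w : int -> F,
  forall k, absF (w k) = q%:R ^ k.
Proof.
have [w [aw _]] := uniformizerP; exists (fun k => w ^ (- k)) => k.
by rewrite absF_exprz aw exprz_inv opprK.
Qed.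

(** An absolute value below 1 is at most [q%:R^-1], so multiplication by [w 1], of absolute value
    [q], climbs to 1 in a bounded number of steps without overshooting. *)
Lemma absF_discrete x : x != 0 -> exists k : int, absF x = q%:R ^ k.
Proof.
have [w hw] := exprz_uniformizer.
have Hint (n : nat) y : y != 0 -> q%:R ^ (- n%:Z) <= absF y <= 1 ->
    exists k : int, absF y = q%:R ^ k.
  elim: n y => [|n IH] y y0 /andP[lb ub].
    by exists 0; apply/eqP; rewrite eq_le {1}expr0z ub.
  have [y1|] := ltP (absF y) 1; last first.
    by move=> h; exists 0; rewrite expr0z; apply/eqP; rewrite eq_le ub.
  have w1 : w 1 != 0 by rewrite -absF_eq0 hw expr1z qR_neq0.
  have [||k hk] := IH (y * w 1); first by rewrite mulf_neq0.
    rewrite absFM hw expr1z; apply/andP; split.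
      rewrite -ler_pdivrMr ?qR_gt0//; apply: le_trans lb.
      by rewrite -exprN1 -qzD ler_qz; lia.
    by rewrite -ler_pdivlMr ?qR_gt0// div1r absF_lt1_le.
  exists (k - 1); move: hk; rewrite absFM hw => e.
  by rewrite qzD -e -mulrA -qzD subrr expr0z mulr1.
move=> x0.
have [n hn] := qz_large (absF x); have [m hm] := qz_large (absF x)^-1.
have ax : 0 < absF x by rewrite absF_gt0.
have [||k hk] := Hint (m + n)%N (x * w (- n%:Z)).
- by rewrite mulf_neq0// -absF_eq0 hw gt_eqF// qz_gt0.
- rewrite absFM hw; apply/andP; split.
    rewrite PoszD opprD qzD ler_pM2r ?qz_gt0// -invr_expz.
    by rewrite -[leRHS]invrK lef_pV2// ?posrE ?qz_gt0// invr_gt0.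
  apply: le_trans (ler_wpM2r _ hn) _; first exact/ltW/qz_gt0.
  by rewrite -qzD subrr expr0z.
exists (k + n); rewrite qzD -hk absFM hw -mulrA -qzD.
by rewrite addrC subrr expr0z mulr1.
Qed.

Lemma absF_lt_qz x (k : int) : (absF x < q%:R ^ k) = (absF x <= q%:R ^ (k - 1)).
Proof.
have [->|x0] := eqVneq x 0; first by rewrite absF0 qz_gt0 ltW// qz_gt0.
by have [l ->] := absF_discrete x0; rewrite ltr_qz ler_qz; lia.
Qed.

Lemma residue_reps : exists rep : 'I_q -> F, [/\
  forall i, absF (rep i) <= 1,
  forall x, absF x <= 1 -> exists i, absF (x - rep i) < 1 &
  forall i j, absF (rep i - rep j) < 1 -> i = j].
Proof.
have : (`I_q #= residue_cosets absF)%card.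
  by rewrite card_eq_sym; exact: residue_card HF.
move=> /card_set_bijP[f [f_fun f_inj f_surj]].
have /choice[rep hrep] (i : 'I_q) : exists a,
    absF a <= 1 /\ f i = [set a + x | x in maximal_ideal absF].
  have : residue_cosets absF (f i) by apply: f_fun => /=; exact: ltn_ord.
  by case=> a a1 <-; exists a.
have coset0 a : [set a + x | x in maximal_ideal absF] a.
  by exists 0; rewrite ?addr0// /maximal_ideal/= absF0 ltr01.
exists rep; split.
- by move=> i; have [] := hrep i.
- move=> x x1.
  have [] := f_surj [set x + y | y in maximal_ideal absF]; first by exists x.
  move=> i iq e; exists (Ordinal iq).
  have [_] := hrep (Ordinal iq); rewrite /= e => {}e.
  by have := coset0 x; rewrite e => -[y my <-]; rewrite addrC addKr.
- move=> i j ij; apply/val_inj/f_inj; rewrite ?inE/= ?ltn_ord//.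
  have [_ ->] := hrep i; have [_ ->] := hrep j.
  apply/seteqP; split => _ [x mx <-].
    exists (rep i - rep j + x); last by rewrite addrA addrCA subrr addr0.
    exact: absF_add_lt.
  exists (rep j - rep i + x); last by rewrite addrA addrCA subrr addr0.
  by apply: absF_add_lt => //; rewrite absF_subC.
Qed.

Lemma absF_2 p : residual_char absF p -> odd p -> absF 2 = 1.
Proof.
move=> [_ p1] podd; apply/eqP; rewrite eq_le absF_nat_le1/= leNgt.
apply/negP => h; suff : absF 1 < 1 by rewrite absF1 ltxx.
(* As [p] is odd, 1 is [p] minus an even integer, and both would lie in the maximal ideal. *)
have -> : 1 = p%:R - 2 * (p./2)%:R :> F.
  by rewrite -natrM mul2n -{1}(odd_double_half p) podd natrD addrK.
apply: absF_sub_lt => //; rewrite absFM.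
apply: le_lt_trans h; rewrite ler_piMr ?absF_ge0 ?absF_nat_le1//.
Qed.

End AbsoluteValue.

(** * Squares and isotropic diagonal forms in odd residual characteristic *)

Section Squares.
Context {R : realType} {F : fieldType} {absF : F -> R} {q p : nat}.
Hypothesis HF : local_field absF q.
Hypotheses (p_char : residual_char absF p) (p_odd : odd p).

Let abs2 : absF 2 = 1 := absF_2 HF p_char p_odd.

Lemma two_neq0 : 2 != 0 :> F.
Proof. by rewrite -(absF_eq0 HF) abs2 oner_eq0. Qed.

Lemma expr_lt1_small (c e : R) : 0 <= c < 1 -> c <= q%:R^-1 -> 0 < e ->
  exists N, forall n, (N <= n)%N -> c ^+ n < e.
Proof.
move=> /andP[c0 c1] cq e0; have [N hN] := qz_large HF (e^-1 + 1).
exists N => n Nn; apply: le_lt_trans (_ : c ^+ N < e).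
  by rewrite ler_wiXn2l// ltW.
apply: le_lt_trans (_ : (q%:R^-1) ^+ N < e).
  by apply: lerXn2r => //; rewrite nnegrE// invr_ge0 ltW// (qR_gt0 HF).
rewrite exprVn -[ltRHS]invrK ltf_pV2 ?posrE ?invr_gt0//.
  by apply: lt_le_trans hN; rewrite ltrDl.
exact: qz_gt0 HF N%:Z.
Qed.

Lemma hensel_sqrt u x0 : absF x0 = 1 -> absF (x0 ^+ 2 - u) < 1 -> is_square u.
Proof.
move=> x01 hlt; set c := absF (x0 ^+ 2 - u).
have c01 : 0 <= c < 1 by rewrite (absF_ge0 HF).
have [c0 c1] := andP c01.
have cq : c <= q%:R^-1 by exact: absF_lt1_le HF _ hlt.
pose x n : F := iter n (fun a : F => a - (a ^+ 2 - u) / (2 * a)) x0.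
have xS n : x n.+1 = x n - (x n ^+ 2 - u) / (2 * x n) by [].
have step n : absF (x n) = 1 -> absF (x n.+1 - x n) = absF (x n ^+ 2 - u).
  move=> xn1; rewrite xS addrC addKr (absFN HF) (absF_div HF) (absFM HF).
  by rewrite abs2 xn1 mul1r divr1.
have inv n : absF (x n) = 1 /\ absF (x n ^+ 2 - u) <= c ^+ n.+1.
  elim: n => [|n [xn1 IH]]; first by rewrite expr1.
  have cn : c ^+ n.+1 < 1 by rewrite exprn_ilt1.
  split.
    rewrite -(subrK (x n) (x n.+1)) (absF_addl_lt HF)// step// xn1.
    exact: le_lt_trans cn.
  have xn0 : x n != 0 by rewrite -(absF_eq0 HF) xn1 oner_eq0.
  have -> : x n.+1 ^+ 2 - u = (x n.+1 - x n) ^+ 2.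
    by rewrite xS; move: (x n) xn0 => a a0; field; rewrite a0 two_neq0.
  rewrite (absFX HF) step//; apply: le_trans (_ : (c ^+ n.+1) ^+ 2 <= _).
    by apply: lerXn2r => //; rewrite nnegrE ?(absF_ge0 HF)// exprn_ge0.
  by rewrite -exprM; apply: ler_wiXn2l; rewrite ?(ltW c1)//; lia.
have cauchy n m : absF (x (n + m)%N - x n) <= c ^+ n.+1.
  elim: m => [|m IH]; first by rewrite addn0 subrr (absF0 HF) exprn_ge0.
  have -> : x (n + m.+1)%N - x n = (x (n + m).+1 - x (n + m)%N) + (x (n + m)%N - x n).
    by rewrite addrA subrK addnS.
  apply: (absF_add_le HF) => //.
  have [h1 h2] := inv (n + m)%N; rewrite step//; apply: le_trans h2 _.
  by apply: ler_wiXn2l; rewrite ?(ltW c1)//; lia.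
have [] := abs_complete HF (u := x).
  move=> e e0; have [N hN] := expr_lt1_small c01 cq e0.
  exists N => m n Nm Nn.
  have h k : (N <= k)%N -> absF (x k - x N) < e.
    move=> Nk; rewrite -(subnKC Nk); apply: le_lt_trans (cauchy _ _) _.
    by apply: hN.
  have -> : x m - x n = (x m - x N) - (x n - x N) by rewrite opprB addrA subrK.
  by apply: (absF_sub_lt HF); exact: h.
move=> l hl; exists l; apply/eqP; rewrite -subr_eq0 -(absF_eq0 HF).
rewrite eq_le (absF_ge0 HF) andbT; apply/ler_addgt0Pr => e e0; rewrite add0r.
pose e' := Num.min e 1; have e'0 : 0 < e' by rewrite lt_min e0 ltr01.
have [N1 h1] := hl e' e'0; have [N2 h2] := expr_lt1_small c01 cq e0.
pose n := maxn N1 N2.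
have dl : absF (x n - l) < e' by apply: h1; rewrite leq_maxl.
have [xn1 xnu] := inv n.
have l1 : absF (x n + l) <= 1.
  have -> : x n + l = 2 * x n - (x n - l) by ring.
  apply: (absF_sub_le HF); first by rewrite (absFM HF) abs2 xn1 mul1r.
  by apply: le_trans (ltW dl) _; rewrite ge_min lexx orbT.
have -> : u - l ^+ 2 = (x n - l) * (x n + l) - (x n ^+ 2 - u) by ring.
apply: (absF_sub_le HF).
  rewrite (absFM HF); apply: le_trans (_ : absF (x n - l) * 1 <= _).
    by apply: ler_wpM2l => //; exact: absF_ge0 HF _.
  by rewrite mulr1 (le_trans (ltW dl))// ge_min lexx.
apply: le_trans xnu _; apply/ltW/h2.
by rewrite (leq_trans (leq_maxr N1 N2)).
Qed.

(** Arithmetic of the residue field, carried by representatives in [F]. Squaring has fibres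
    [{k, -k}], and the fibre over the class of zero is a single point, whence
    [q <= 1 + 2 * (#|Sq| - 1)]. *)
Lemma residue_squares_card : exists (rep : 'I_q -> F) (cl : F -> 'I_q)
    (Sq : {set 'I_q}),
  [/\ forall i, absF (rep i) <= 1,
      forall x, absF x <= 1 -> absF (x - rep (cl x)) < 1,
      forall i j, absF (rep i - rep j) < 1 -> i = j,
      forall i, i \in Sq -> exists k, absF (rep k ^+ 2 - rep i) < 1
    & (q < 2 * #|Sq|)%N].
Proof.
have [rep [rep1 rep_ex rep_inj]] := residue_reps HF.
have q0 : (0 < q)%N := ltnW (residue_gt1 HF).
have /choice[cl hcl] (x : F) : exists i : 'I_q,
    absF x <= 1 -> absF (x - rep i) < 1.
  have [x1|x1] := boolP (absF x <= 1); last by exists (Ordinal q0).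
  by have [i hi] := rep_ex x x1; exists i.
pose sq i := cl (rep i ^+ 2).
have sqP i : absF (rep i ^+ 2 - rep (sq i)) < 1.
  by apply: hcl; rewrite (absFX HF) exprn_ile1// (absF_ge0 HF).
pose neg i := cl (- rep i).
have negP' i : absF (rep i + rep (neg i)) < 1.
  by rewrite -(absFN HF) opprD; apply: hcl; rewrite (absFN HF).
have fib i j : sq i = sq j -> i = j \/ i = neg j.
  move=> e; have : absF ((rep i - rep j) * (rep i + rep j)) < 1.
    have -> : (rep i - rep j) * (rep i + rep j) =
      (rep i ^+ 2 - rep (sq i)) - (rep j ^+ 2 - rep (sq i)) by ring.
    by apply: (absF_sub_lt HF); rewrite // e.
  rewrite (absFM HF) => h.
  have [lt1|ge1] := ltP (absF (rep i - rep j)) 1; first by left; exact: rep_inj.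
  right; apply: rep_inj.
  have -> : rep i - rep (neg j) = (rep i + rep j) - (rep j + rep (neg j)) by ring.
  apply: (absF_sub_lt HF) => //; apply: le_lt_trans h.
  by rewrite ler_peMl// (absF_ge0 HF).
pose z := cl 0.
have z1 : absF (rep z) < 1.
  by rewrite -(absFN HF) -[X in absF X]add0r; apply: hcl; rewrite (absF0 HF) ler01.
have negz : neg z = z.
  apply: rep_inj.
  have -> : rep (neg z) - rep z = (rep z + rep (neg z)) - (rep z + rep z) by ring.
  by apply: (absF_sub_lt HF) => //; apply: (absF_add_lt HF).
exists rep, cl, (sq @: 'I_q)%SET; split => //.
  by move=> i /imsetP[k _ ->]; exists k.
set Sq := (sq @: 'I_q)%SET.
have zS : sq z \in Sq by rewrite imset_f.
have : (\sum_(i : 'I_q) 1 = \sum_(j in Sq) \sum_(i | sq i == j) 1)%N.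
  by rewrite (partition_big sq (mem Sq))//= => i _; rewrite imset_f.
rewrite sum1_card card_ord (bigD1 (sq z))//= sum1dep_card.
have -> : #|[set x | sq x == sq z]%SET| = 1%N.
  apply/eqP/cards1P; exists z; apply/setP => i; rewrite !inE.
  apply/eqP/eqP => [/fib|->//]; first by rewrite negz; case.
move=> qE.
have hb : (\sum_(i in Sq | i != sq z) \sum_(i0 | sq i0 == i) 1
    <= \sum_(i in Sq | i != sq z) 2)%N.
  apply: leq_sum => j /andP[/imsetP[k _ ->] _]; rewrite sum1dep_card.
  apply: leq_trans (_ : #|[set k; neg k]%SET| <= _)%N.
    by apply: subset_leq_card; apply/fintype.subsetP => i; rewrite !inE => /eqP/fib[]->;
      rewrite eqxx ?orbT.
  by rewrite cards2; case: (_ != _).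
have : (\sum_(i in Sq | i != sq z) 2 = 2 * #|Sq|.-1)%N.
  rewrite (cardsD1 (sq z) Sq) zS /= mulnC -sum_nat_const.
  by apply: eq_bigl => i; rewrite !inE andbC.
have : (0 < #|Sq|)%N by apply/card_gt0P; exists (sq z).
rewrite -ltnS; move: qE hb; set s := (\sum_(i in Sq | _) _)%N.
by move: #|Sq| s => m s; lia.
Qed.

(** Multiplication by the nonsquare [u] sends [Sq] to a set meeting [Sq] at most in the zero class,
    since a common unit class would make [u] a square. By counting, the two sets cover all classes;
    as [v] is not in the first, it is [u] times a square modulo the maximal ideal. *)
Lemma square_unit_of_nonsquares u v : absF u = 1 -> absF v = 1 ->
  ~ is_square u -> ~ is_square v -> is_square (u * v).
Proof.
move=> u1 v1 nu nv.
have [rep [cl [Sq [rep1 hcl rep_inj SqP Sqc]]]] := residue_squares_card.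
have u0 : u != 0 by rewrite -(absF_eq0 HF) u1 oner_eq0.
have v0 : v != 0 by rewrite -(absF_eq0 HF) v1 oner_eq0.
pose f i := cl (u * rep i).
have fP i : absF (u * rep i - rep (f i)) < 1.
  by apply: hcl; rewrite (absFM HF) u1 mul1r.
have f_inj : injective f.
  move=> i j e; apply: rep_inj; rewrite -(absF_mul_unit HF _ u1).
  have -> : u * (rep i - rep j) =
    (u * rep i - rep (f i)) - (u * rep j - rep (f i)) by ring.
  by apply: (absF_sub_lt HF); rewrite // e.
have unit_of (a b : F) : absF a = 1 -> absF (b - a) < 1 -> absF b = 1.
  by move=> a1 ba; rewrite (absF_close HF ba)// a1.
have nz x : absF x ^+ 2 = 1 -> absF x = 1.
  move=> /eqP; rewrite sqrf_eq1 => /orP[/eqP//|/eqP h].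
  by have := absF_ge0 HF x; rewrite h; lra.
have only0 i : i \in Sq -> i \in (f @: Sq)%SET -> absF (rep i) < 1.
  move=> /SqP[k hk] /imsetP[j /SqP[l hl] ij].
  rewrite lt_neqAle rep1 andbT; apply/negP => /eqP ri1.
  have k1 : absF (rep k) = 1.
    by apply: nz; rewrite -(absFX HF); exact: unit_of ri1 hk.
  have rj1 : absF (rep j) = 1.
    rewrite -(absF_mul_unit HF _ u1); apply: (unit_of (rep i)) => //.
    by rewrite ij.
  have l1 : absF (rep l) = 1.
    by apply: nz; rewrite -(absFX HF); exact: unit_of rj1 hl.
  have l0 : rep l != 0 by rewrite -(absF_eq0 HF) l1 oner_eq0.
  apply: nu; apply: (hensel_sqrt (x0 := rep k / rep l)).
    by rewrite (absF_div HF) k1 l1 divr1.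
  have -> : (rep k / rep l) ^+ 2 - u = (rep l)^-1 ^+ 2 *
      ((rep k ^+ 2 - rep i) - (u * rep j - rep (f j))
       - u * (rep l ^+ 2 - rep j)).
    by rewrite ij; field.
  rewrite (absFM HF) (absFX HF) (absFV HF) l1 invr1 expr1n mul1r.
  apply: (absF_sub_lt HF); first exact: (absF_sub_lt HF).
  by rewrite (absFM HF) u1 mul1r.
have IU : (#|Sq :&: f @: Sq| <= 1)%N.
  apply/card_le1_eqP => i j; rewrite !finset.in_setI => /andP[i1 i2] /andP[j1 j2].
  by apply: rep_inj; apply: (absF_sub_lt HF); exact: only0.
have full : (Sq :|: f @: Sq)%SET = [set: 'I_q]%SET.
  apply/eqP; rewrite eqEcard finset.subsetT/= cardsT card_ord.
  have := cardsUI Sq (f @: Sq); rewrite card_imset// => e.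
  move: e IU Sqc; move: #|_ :|: _| #|_ :&: _| #|Sq| => a b c; lia.
have vcl : absF (v - rep (cl v)) < 1 by apply: hcl; rewrite v1.
have rv1 : absF (rep (cl v)) = 1.
  by apply: (unit_of v) => //; rewrite (absF_subC HF).
have : cl v \in [set: 'I_q]%SET by rewrite finset.in_setT.
rewrite -full finset.in_setU => /orP[/SqP[k hk]|/imsetP[j /SqP[l hl] vj]].
  case: nv; apply: (hensel_sqrt (x0 := rep k)).
    by apply: nz; rewrite -(absFX HF); exact: unit_of rv1 hk.
  have -> : rep k ^+ 2 - v = (rep k ^+ 2 - rep (cl v)) - (v - rep (cl v)) by ring.
  exact: (absF_sub_lt HF).
have rj1 : absF (rep j) = 1.
  rewrite -(absF_mul_unit HF _ u1); apply: (unit_of (rep (cl v))) => //.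
  by rewrite vj.
have l1 : absF (rep l) = 1.
  by apply: nz; rewrite -(absFX HF); exact: unit_of rj1 hl.
apply: (hensel_sqrt (x0 := u * rep l)); first by rewrite (absFM HF) u1 l1 mulr1.
have -> : (u * rep l) ^+ 2 - u * v = u * (u * (rep l ^+ 2 - rep j)
   + (u * rep j - rep (f j)) - (v - rep (cl v))) by rewrite vj; ring.
rewrite (absFM HF) u1 mul1r; apply: (absF_sub_lt HF) => //.
by apply: (absF_add_lt HF) => //; rewrite (absFM HF) u1 mul1r.
Qed.

(** Pigeonhole: the classes [u * x ^+ 2] and [- 1 - v * y ^+ 2] each fill more than half of the
    residue field, so they meet. One of the two variables is a unit, for otherwise 1 would lie in
    the maximal ideal, and Hensel's lemma corrects that one. *)
Lemma unit_binary_form_unit u v : absF u = 1 -> absF v = 1 ->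
  exists x y, u * x ^+ 2 + v * y ^+ 2 + 1 = 0.
Proof.
move=> u1 v1.
have [rep [cl [Sq [rep1 hcl rep_inj SqP Sqc]]]] := residue_squares_card.
have u0 : u != 0 by rewrite -(absF_eq0 HF) u1 oner_eq0.
have v0 : v != 0 by rewrite -(absF_eq0 HF) v1 oner_eq0.
pose f i := cl (u * rep i); pose g i := cl (- 1 - v * rep i).
have fP i : absF (u * rep i - rep (f i)) < 1.
  by apply: hcl; rewrite (absFM HF) u1 mul1r.
have gP i : absF (- 1 - v * rep i - rep (g i)) < 1.
  apply: hcl; apply: (absF_sub_le HF); first by rewrite (absFN HF) (absF1 HF).
  by rewrite (absFM HF) v1 mul1r.
have f_inj : injective f.
  move=> i j e; apply: rep_inj; rewrite -(absF_mul_unit HF _ u1).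
  have -> : u * (rep i - rep j) =
    (u * rep i - rep (f i)) - (u * rep j - rep (f i)) by ring.
  by apply: (absF_sub_lt HF); rewrite // e.
have g_inj : injective g.
  move=> i j e; apply: rep_inj; rewrite -(absF_mul_unit HF _ v1).
  have -> : v * (rep i - rep j) =
    (- 1 - v * rep j - rep (g i)) - (- 1 - v * rep i - rep (g i)) by ring.
  by apply: (absF_sub_lt HF); rewrite // e.
have : (0 < #|f @: Sq :&: g @: Sq|)%N.
  have := cardsUI (f @: Sq)%SET (g @: Sq)%SET; rewrite !card_imset// => e.
  have : (#|f @: Sq :|: g @: Sq| <= q)%N by rewrite -[leqRHS]card_ord max_card.
  move: e Sqc; move: #|_ :|: _| #|_ :&: _| #|Sq| => a b c; lia.
case/card_gt0P => i; rewrite finset.in_setI => /andP[/imsetP[j /SqP[k hk] ij]].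
move=> /imsetP[l /SqP[m hm] il].
pose X := rep k; pose Y := rep m.
have XY : absF (u * X ^+ 2 + v * Y ^+ 2 + 1) < 1.
  have -> : u * X ^+ 2 + v * Y ^+ 2 + 1 = u * (X ^+ 2 - rep j)
    + v * (Y ^+ 2 - rep l) + ((u * rep j - rep (f j))
      - (- 1 - v * rep l - rep (g l))) by rewrite -ij -il; ring.
  apply: (absF_add_lt HF); last exact: (absF_sub_lt HF).
  by apply: (absF_add_lt HF); rewrite (absFM HF) ?u1 ?v1 mul1r.
have lift (a b x y : F) : absF a = 1 -> absF b = 1 -> absF x = 1 ->
    absF (a * x ^+ 2 + b * y ^+ 2 + 1) < 1 ->
    exists z, a * z ^+ 2 + b * y ^+ 2 + 1 = 0.
  move=> a1 b1 x1 h.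
  have a0 : a != 0 by rewrite -(absF_eq0 HF) a1 oner_eq0.
  have [z hz] : is_square (- (b * y ^+ 2 + 1) / a).
    apply: (hensel_sqrt x1).
    have -> : x ^+ 2 - - (b * y ^+ 2 + 1) / a
      = a^-1 * (a * x ^+ 2 + b * y ^+ 2 + 1) by field.
    by rewrite (absFM HF) (absFV HF) a1 invr1 mul1r.
  by exists z; rewrite -hz; field.
have [X1|X1] := eqVneq (absF X) 1.
  by have [z hz] := lift u v X Y u1 v1 X1 XY; exists z, Y.
have Xlt : absF (X ^+ 2) < 1.
  rewrite (absFX HF) exprn_ilt1// ?(absF_ge0 HF)//.
  by rewrite lt_neqAle X1 rep1.
have [Y1|Y1] := eqVneq (absF Y) 1.
  have [|z hz] := lift v u Y X v1 u1 Y1; first by rewrite (addrC (v * _)).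
  by exists X, z; rewrite -hz; ring.
have Ylt : absF (Y ^+ 2) < 1.
  rewrite (absFX HF) exprn_ilt1// ?(absF_ge0 HF)//.
  by rewrite lt_neqAle Y1 rep1.
have : absF 1 < 1.
  have -> : 1 = (u * X ^+ 2 + v * Y ^+ 2 + 1) - (u * X ^+ 2 + v * Y ^+ 2) :> F.
    by ring.
  apply: (absF_sub_lt HF) => //.
  by apply: (absF_add_lt HF); rewrite (absFM HF) ?u1 ?v1 mul1r.
by rewrite (absF1 HF) ltxx.
Qed.

Lemma ternary_isotropic u v s : s != 0 -> absF u = absF s -> absF v = absF s ->
  exists x y, u * x ^+ 2 + v * y ^+ 2 + s = 0.
Proof.
move=> s0 us vs; have as0 : absF s != 0 by rewrite (absF_eq0 HF).
have [||x [y e]] := @unit_binary_form_unit (u / s) (v / s).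
- by rewrite (absF_div HF) us divff.
- by rewrite (absF_div HF) vs divff.
by exists x, y; rewrite -[RHS](mulr0 s) -e; field.
Qed.

(** If neither [- b / a] nor [- d / c] were a square, these two units would have a square product,
    and [a * b * c * d] would be a square. *)
Lemma binary_isotropic a b c d : a != 0 -> c != 0 ->
  absF b = absF a -> absF d = absF c -> ~ is_square (a * b * c * d) ->
  (exists x, a * x ^+ 2 + b = 0) \/ (exists x, c * x ^+ 2 + d = 0).
Proof.
move=> a0 c0 ba dc nsq.
have aa0 : absF a != 0 by rewrite (absF_eq0 HF).
have ac0 : absF c != 0 by rewrite (absF_eq0 HF).
have [[x hx]|n1] := EM (is_square (- b / a)).
  by left; exists x; rewrite -hx; field.
have [[x hx]|n2] := EM (is_square (- d / c)).
  by right; exists x; rewrite -hx; field.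
have [||x hx] := square_unit_of_nonsquares _ _ n1 n2.
- by rewrite (absF_div HF) (absFN HF) ba divff.
- by rewrite (absF_div HF) (absFN HF) dc divff.
case: nsq; exists (x * (a * c)); rewrite exprMn -hx.
by field; rewrite a0 c0.
Qed.

Lemma normalize_by_square d : d != 0 -> exists2 k, k != 0 &
  absF (d * k ^+ 2) = 1 \/ absF (d * k ^+ 2) = q%:R^-1.
Proof.
move=> d0; have [j hj] := absF_discrete HF d0.
have [w hw] := exprz_uniformizer HF.
have [m [e|e]] : exists m : int, j = m *+ 2 \/ j = m *+ 2 - 1.
  have := divz_eq j 2; have := ltz_pmod j (isT : (0 < 2 :> int)).
  have := modz_ge0 j (isT : 2 != 0 :> int).
  move: (j %/ 2)%Z (j %% 2)%Z => k l l0 l2 ->.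
  have [->|->] : l = 0 \/ l = 1 by lia.
    by exists k; left; rewrite mulr2n; lia.
  by exists (k + 1); right; rewrite mulr2n; lia.
all: have w0 : w (- m) != 0 by rewrite -(absF_eq0 HF) hw (qz_neq0 HF).
all: exists (w (- m)) => //.
- left; rewrite (absFM HF) (absFX HF) hw hj expr2 -!(qzD HF).
  have -> : j + (- m + - m) = 0 by lia.
  exact: expr0z.
- right; rewrite (absFM HF) (absFX HF) hw hj expr2 -!(qzD HF).
  have -> : j + (- m + - m) = -1 by lia.
  exact: exprN1.
Qed.

(** After normalization by squares the four coefficients share two absolute values. Either three of
    them agree and the ternary case applies, or they split into two pairs and the hypothesis on the
    discriminant makes one pair isotropic. *)
Lemma quaternary_isotropic (d1 d2 d3 d4 : F) : d1 != 0 -> d2 != 0 -> d3 != 0 ->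
  d4 != 0 -> ~ is_square (d1 * d2 * d3 * d4) ->
  exists x1 x2 x3 x4, [|| x1 != 0, x2 != 0, x3 != 0 | x4 != 0] /\
    d1 * x1 ^+ 2 + d2 * x2 ^+ 2 + d3 * x3 ^+ 2 + d4 * x4 ^+ 2 = 0.
Proof.
move=> n1 n2 n3 n4 nsq.
have [k1 k10 h1] := normalize_by_square n1.
have [k2 k20 h2] := normalize_by_square n2.
have [k3 k30 h3] := normalize_by_square n3.
have [k4 k40 h4] := normalize_by_square n4.
suff [x1 [x2 [x3 [x4 [nz e]]]]] : exists x1 x2 x3 x4,
    [|| x1 != 0, x2 != 0, x3 != 0 | x4 != 0] /\
    (d1 * k1 ^+ 2) * x1 ^+ 2 + (d2 * k2 ^+ 2) * x2 ^+ 2 +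
    (d3 * k3 ^+ 2) * x3 ^+ 2 + (d4 * k4 ^+ 2) * x4 ^+ 2 = 0.
  exists (k1 * x1), (k2 * x2), (k3 * x3), (k4 * x4); split; last by rewrite -[RHS]e; ring.
  by rewrite !mulf_eq0 !negb_or k10 k20 k30 k40.
have {nsq} : ~ is_square ((d1 * k1 ^+ 2) * (d2 * k2 ^+ 2) *
    (d3 * k3 ^+ 2) * (d4 * k4 ^+ 2)).
  move=> -[x hx]; apply: nsq; exists (x / (k1 * k2 * k3 * k4)).
  rewrite expr_div_n -hx; field; rewrite ?k10 ?k20 ?k30 ?k40//.
have {n1} : d1 * k1 ^+ 2 != 0 by rewrite mulf_neq0 ?expf_neq0.
have {n2} : d2 * k2 ^+ 2 != 0 by rewrite mulf_neq0 ?expf_neq0.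
have {n3} : d3 * k3 ^+ 2 != 0 by rewrite mulf_neq0 ?expf_neq0.
have {n4} : d4 * k4 ^+ 2 != 0 by rewrite mulf_neq0 ?expf_neq0.
move: (d1 * _) (d2 * _) (d3 * _) (d4 * _) h1 h2 h3 h4 => {k10 k20 k30 k40}.
move=> {}d1 {}d2 {}d3 {}d4 h1 h2 h3 h4 n4 n3 n2 n1 nsq.
have T123 : absF d1 = absF d2 -> absF d2 = absF d3 -> exists x1 x2 x3 x4,
    [|| x1 != 0, x2 != 0, x3 != 0 | x4 != 0] /\
    d1 * x1 ^+ 2 + d2 * x2 ^+ 2 + d3 * x3 ^+ 2 + d4 * x4 ^+ 2 = 0.
  move=> e1 e2; have [||x [y e]] := @ternary_isotropic d1 d2 d3 n3; rewrite ?e1 ?e2//.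
  exists x, y, 1, 0; split; first by rewrite oner_eq0 /= !orbT.
  by rewrite -[RHS]e; ring.
have T124 : absF d1 = absF d2 -> absF d2 = absF d4 -> exists x1 x2 x3 x4,
    [|| x1 != 0, x2 != 0, x3 != 0 | x4 != 0] /\
    d1 * x1 ^+ 2 + d2 * x2 ^+ 2 + d3 * x3 ^+ 2 + d4 * x4 ^+ 2 = 0.
  move=> e1 e2; have [||x [y e]] := @ternary_isotropic d1 d2 d4 n4; rewrite ?e1 ?e2//.
  exists x, y, 0, 1; split; first by rewrite oner_eq0 /= !orbT.
  by rewrite -[RHS]e; ring.
have T134 : absF d1 = absF d3 -> absF d3 = absF d4 -> exists x1 x2 x3 x4,
    [|| x1 != 0, x2 != 0, x3 != 0 | x4 != 0] /\
    d1 * x1 ^+ 2 + d2 * x2 ^+ 2 + d3 * x3 ^+ 2 + d4 * x4 ^+ 2 = 0.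
  move=> e1 e2; have [||x [y e]] := @ternary_isotropic d1 d3 d4 n4; rewrite ?e1 ?e2//.
  exists x, 0, y, 1; split; first by rewrite oner_eq0 /= !orbT.
  by rewrite -[RHS]e; ring.
have T234 : absF d2 = absF d3 -> absF d3 = absF d4 -> exists x1 x2 x3 x4,
    [|| x1 != 0, x2 != 0, x3 != 0 | x4 != 0] /\
    d1 * x1 ^+ 2 + d2 * x2 ^+ 2 + d3 * x3 ^+ 2 + d4 * x4 ^+ 2 = 0.
  move=> e1 e2; have [||x [y e]] := @ternary_isotropic d2 d3 d4 n4; rewrite ?e1 ?e2//.
  exists 0, x, y, 1; split; first by rewrite oner_eq0 /= !orbT.
  by rewrite -[RHS]e; ring.
have P12 : absF d2 = absF d1 -> absF d4 = absF d3 -> exists x1 x2 x3 x4,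
    [|| x1 != 0, x2 != 0, x3 != 0 | x4 != 0] /\
    d1 * x1 ^+ 2 + d2 * x2 ^+ 2 + d3 * x3 ^+ 2 + d4 * x4 ^+ 2 = 0.
  move=> e1 e2; have [[x e]|[x e]] := binary_isotropic n1 n3 e1 e2 nsq.
    exists x, 1, 0, 0; rewrite oner_eq0 /= !orbT; split => //; rewrite -[RHS]e; ring.
  exists 0, 0, x, 1; rewrite oner_eq0 /= !orbT; split => //; rewrite -[RHS]e; ring.
have P13 : absF d3 = absF d1 -> absF d4 = absF d2 -> exists x1 x2 x3 x4,
    [|| x1 != 0, x2 != 0, x3 != 0 | x4 != 0] /\
    d1 * x1 ^+ 2 + d2 * x2 ^+ 2 + d3 * x3 ^+ 2 + d4 * x4 ^+ 2 = 0.
  move=> e1 e2; have [|[x e]|[x e]] := binary_isotropic n1 n2 e1 e2 _.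
  - by rewrite (_ : _ * _ = d1 * d2 * d3 * d4)//; ring.
  - exists x, 0, 1, 0; rewrite oner_eq0 /= !orbT; split => //; rewrite -[RHS]e; ring.
  - exists 0, x, 0, 1; rewrite oner_eq0 /= !orbT; split => //; rewrite -[RHS]e; ring.
have P14 : absF d4 = absF d1 -> absF d3 = absF d2 -> exists x1 x2 x3 x4,
    [|| x1 != 0, x2 != 0, x3 != 0 | x4 != 0] /\
    d1 * x1 ^+ 2 + d2 * x2 ^+ 2 + d3 * x3 ^+ 2 + d4 * x4 ^+ 2 = 0.
  move=> e1 e2; have [|[x e]|[x e]] := binary_isotropic n1 n2 e1 e2 _.
  - by rewrite (_ : _ * _ = d1 * d2 * d3 * d4)//; ring.
  - exists x, 0, 0, 1; rewrite oner_eq0 /= !orbT; split => //; rewrite -[RHS]e; ring.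
  - exists 0, x, 1, 0; rewrite oner_eq0 /= !orbT; split => //; rewrite -[RHS]e; ring.
(* Only equalities between absolute values matter now, so the two constants become variables and the
   sixteen patterns are enumerated. *)
move: (1 : R) (q%:R^-1 : R) h1 h2 h3 h4 => c c' h1 h2 h3 h4.
by case: h1 h2 h3 h4 T123 T124 T134 T234 P12 P13 P14
  => -> [] -> [] -> [] ->; auto.
Qed.

(** An isotropic vector makes the two binary forms take a common value. If this value is 0, one of
    the forms is a hyperbolic plane and takes every value: the second one when [y = 0], where it is
    made equal to 1, and the first one otherwise, where it is made equal to [A * D]. *)
Lemma common_norm_value (A D r : F) : A != 0 -> D != 0 -> r != 0 -> ~ is_square A ->
  exists x y z t : F, x ^+ 2 - r * y ^+ 2 = A * D * z ^+ 2 - r * D * t ^+ 2 /\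
    x ^+ 2 - r * y ^+ 2 != 0.
Proof.
move=> A0 D0 r0 nA; have n2 := two_neq0.
have [|||||x [y [z [t [nz e]]]]] := @quaternary_isotropic 1 (- r) (- (A * D)) (r * D).
- exact: oner_neq0.
- by rewrite oppr_eq0.
- by rewrite oppr_eq0 mulf_neq0.
- exact: mulf_neq0.
(* The discriminant is [A * (r * D) ^+ 2]. *)
- move=> -[k hk]; apply: nA; exists (k / (r * D)).
  by rewrite expr_div_n -hk; field; rewrite r0 D0.
have [a0|a0] := eqVneq (x ^+ 2 - r * y ^+ 2) 0; last first.
  exists x, y, z, t; split => //; apply/eqP; rewrite -subr_eq0; apply/eqP.
  by rewrite -[RHS]e; ring.
have [y0|y0] := eqVneq y 0.
  move: a0; rewrite y0 expr0n mulr0 subr0 => /eqP; rewrite sqrf_eq0 => /eqP x0.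
  have {}e : A * z ^+ 2 = r * t ^+ 2.
    apply: (mulfI D0); apply/eqP; rewrite -subr_eq0; apply/eqP.
    by rewrite -[RHS]oppr0 -[in RHS]e x0 y0; ring.
  have t0 : t != 0.
    apply/eqP => t0; move: e nz; rewrite x0 y0 t0 expr0n mulr0 eqxx/= => /eqP.
    by rewrite mulf_eq0 (negPf A0) sqrf_eq0 /= orbF => ->.
  have z0 : z != 0.
    apply/eqP => z0; move: e; rewrite z0 expr0n mulr0 => /esym/eqP.
    by rewrite mulf_eq0 (negPf r0) sqrf_eq0 (negPf t0).
  have rE : r = A * (z / t) ^+ 2.
    apply: (mulIf (expf_neq0 2 t0)); rewrite -e expr_div_n.
    by rewrite -mulrA divfK// expf_neq0.
  pose m := (A * D)^-1.
  exists 1, 0, ((m + 1) / 2), ((m - 1) / (2 * (z / t))); split; last first.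
    by rewrite expr0n mulr0 subr0 expr1n oner_eq0.
  by rewrite rE /m; field; rewrite n2 z0 t0 D0 A0.
have rE : r = (x / y) ^+ 2.
  apply: (mulIf (expf_neq0 2 y0)); rewrite expr_div_n divfK ?expf_neq0//.
  by apply/eqP; rewrite eq_sym -subr_eq0; apply/eqP.
have x0 : x != 0.
  by apply/eqP => x0; move: r0; rewrite rE x0 mul0r expr0n eqxx.
exists ((A * D + 1) / 2), ((A * D - 1) / (2 * (x / y))), 1, 0.
have -> : ((A * D + 1) / 2) ^+ 2 - r * ((A * D - 1) / (2 * (x / y))) ^+ 2 = A * D.
  by rewrite rE; field; rewrite n2 x0 y0.
by split; [ring | rewrite mulf_neq0].
Qed.

End Squares.

(** * Norms and compact open subsets of the four-dimensional space *)

Section CompactOpen.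
Context {R : realType} {F : fieldType} {absF : F -> R} {q : nat}.
Hypothesis HF : local_field absF q.
Local Notation V := (F * F * F * F)%type.
Local Notation qz k := (q%:R ^ (k : int) : R).

Definition nrm (v : V) : R :=
  Num.max (Num.max (absF v.1.1.1) (absF v.1.1.2))
          (Num.max (absF v.1.2) (absF v.2)).

Definition smul (c : F) (v : V) : V :=
  (c * v.1.1.1, c * v.1.1.2, c * v.1.2, c * v.2).

Lemma nrm_leP v (c : R) : reflect
  [/\ absF v.1.1.1 <= c, absF v.1.1.2 <= c, absF v.1.2 <= c & absF v.2 <= c]
  (nrm v <= c).
Proof.
rewrite /nrm !ge_max; apply: (iffP idP).
  by move=> /andP[/andP[? ?] /andP[? ?]]; split.
by move=> [-> -> -> ->].
Qed.

Lemma nrm_ltP v (c : R) : reflect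
  [/\ absF v.1.1.1 < c, absF v.1.1.2 < c, absF v.1.2 < c & absF v.2 < c]
  (nrm v < c).
Proof.
rewrite /nrm !gt_max; apply: (iffP idP).
  by move=> /andP[/andP[? ?] /andP[? ?]]; split.
by move=> [-> -> -> ->].
Qed.

Lemma nrm_ge0 v : 0 <= nrm v.
Proof. by rewrite /nrm !le_max (absF_ge0 HF). Qed.

Lemma nrm_add_le v w (c : R) : nrm v <= c -> nrm w <= c -> nrm (v + w) <= c.
Proof.
move=> /nrm_leP[v1 v2 v3 v4] /nrm_leP[w1 w2 w3 w4]; apply/nrm_leP.
by split; apply: (absF_add_le HF).
Qed.

Lemma nrm_opp v : nrm (- v) = nrm v.
Proof. by rewrite /nrm/= !(absFN HF). Qed.

Lemma nrm_sub_le v w (c : R) : nrm v <= c -> nrm w <= c -> nrm (v - w) <= c.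
Proof. by move=> vc wc; apply: nrm_add_le => //; rewrite nrm_opp. Qed.

Lemma nrm_subC v w : nrm (v - w) = nrm (w - v).
Proof. by rewrite -nrm_opp opprB. Qed.

Lemma nrm_smul c v : nrm (smul c v) = absF c * nrm v.
Proof. by rewrite /nrm/= !(absFM HF) !maxr_pMr ?(absF_ge0 HF)//. Qed.

Lemma nrm_lt_qz v (k : int) : (nrm v < qz k) = (nrm v <= qz (k - 1)).
Proof. by rewrite /nrm !gt_max !ge_max !(absF_lt_qz HF). Qed.

Lemma nrm0 : nrm 0 = 0.
Proof. by rewrite /nrm/= !(absF0 HF) !maxxx. Qed.

Lemma smulA c d v : smul c (smul d v) = smul (c * d) v.
Proof. by rewrite /smul/= !mulrA. Qed.

Lemma smulDr c v w : smul c (v + w) = smul c v + smul c w.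
Proof. by rewrite /smul/= !mulrDr. Qed.

Lemma smulNr c v : smul c (- v) = - smul c v.
Proof. by rewrite /smul/= !mulrN. Qed.

Lemma smulBr c v w : smul c (v - w) = smul c v - smul c w.
Proof. by rewrite smulDr smulNr. Qed.

Lemma smul1 v : smul 1 v = v.
Proof. by case: v => [[[a b] z] t]; rewrite /smul/= !mul1r. Qed.

Lemma smul0 c : smul c 0 = 0.
Proof. by rewrite /smul/= !mulr0. Qed.

Lemma eq_setP (T : Type) (A B : set T) : (forall x, A x <-> B x) -> A = B.
Proof. by move=> h; apply/seteqP; split => x /h. Qed.

Definition periodic (n : int) (S : set V) :=
  forall v e, S v -> nrm e <= qz (- n) -> S (v + e).

Definition bounded_by (n : int) (S : set V) := forall v, S v -> nrm v <= qz n.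

(** The uniform radius of periodicity plays the role of compactness: such a set is a finite disjoint
    union of balls of one radius. *)
Definition compact_open (S : set V) :=
  exists n : nat, bounded_by n S /\ periodic n S.

Lemma periodicW (m n : int) S : m <= n -> periodic m S -> periodic n S.
Proof.
by move=> mn h v e Sv en; apply: h => //; apply: le_trans en _; rewrite (ler_qz HF) lerN2.
Qed.

Lemma bounded_byW (m n : int) S : m <= n -> bounded_by m S -> bounded_by n S.
Proof.
by move=> mn h v Sv; apply: le_trans (h v Sv) _; rewrite (ler_qz HF).
Qed.

Lemma compact_openP (m n : int) S :
  bounded_by m S -> periodic n S -> compact_open S.
Proof.
move=> b p; exists (maxn `|m|%N `|n|%N); split.
  by apply: bounded_byW b; lia.
by apply: periodicW p; lia.
Qed.

Lemma compact_open0 : compact_open set0.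
Proof. by exists 0%N; split. Qed.

Lemma compact_open_common S T : compact_open S -> compact_open T ->
  exists n : nat, [/\ bounded_by n S, periodic n S, bounded_by n T & periodic n T].
Proof.
move=> [n [bS pS]] [m [bT pT]]; exists (maxn n m); split.
- by apply: bounded_byW bS; lia.
- by apply: periodicW pS; lia.
- by apply: bounded_byW bT; lia.
- by apply: periodicW pT; lia.
Qed.

Lemma compact_openU S T :
  compact_open S -> compact_open T -> compact_open (S `|` T).
Proof.
move=> cS cT; have [n [bS pS bT pT]] := compact_open_common cS cT.
exists n; split; first by move=> v [/bS|/bT].
by move=> v e [Sv|Tv] en; [left; exact: pS|right; exact: pT].
Qed.

Lemma compact_openI S T :
  compact_open S -> compact_open T -> compact_open (S `&` T).
Proof.
move=> cS cT; have [n [bS pS bT pT]] := compact_open_common cS cT.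
exists n; split; first by move=> v [/bS].
by move=> v e [Sv Tv] en; split; [exact: pS|exact: pT].
Qed.

Lemma compact_openD S T :
  compact_open S -> compact_open T -> compact_open (S `\` T).
Proof.
move=> cS cT; have [n [bS pS bT pT]] := compact_open_common cS cT.
exists n; split; first by move=> v [/bS].
move=> v e [Sv Tv] en; split; first exact: pS.
by move=> h; apply: Tv; rewrite -(addrK e v); apply: pT => //; rewrite nrm_opp.
Qed.

Lemma compact_open_shift S u :
  compact_open S -> compact_open [set v | S (v - u)].
Proof.
move=> [n [bS pS]]; have [m hm] := qz_large HF (nrm u).
apply: (@compact_openP (maxn n m) n).
  move=> v /= /bS h; rewrite -(subrK u v); apply: nrm_add_le.
    by apply: le_trans h _; rewrite (ler_qz HF); lia.
  by apply: le_trans hm _; rewrite (ler_qz HF); lia.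
by move=> v e /= Sv en; rewrite addrAC; exact: pS.
Qed.

Lemma compact_open_ball0 (n : int) : compact_open [set v | nrm v <= qz n].
Proof.
apply: (@compact_openP n (- n)) => // v e /= vn en.
by apply: nrm_add_le => //; rewrite opprK in en.
Qed.

Lemma compact_open_smul S c : c != 0 ->
  compact_open S -> compact_open [set v | S (smul c v)].
Proof.
move=> c0 [n [bS pS]]; have [k hk] := absF_discrete HF c0.
apply: (@compact_openP (n%:Z - k) (n%:Z + k)).
  move=> v /= /bS; rewrite nrm_smul hk => h.
  rewrite (qzD HF) -(ler_pM2l (qz_gt0 HF k)); apply: le_trans h _.
  by rewrite mulrCA -(qzD HF) subrr expr0z mulr1.
move=> v e /= Sv en; rewrite smulDr; apply: pS => //.
rewrite nrm_smul hk; apply: le_trans (ler_wpM2l (ltW (qz_gt0 HF k)) en) _.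
by rewrite -(qzD HF) (ler_qz HF); lia.
Qed.

Lemma compact_open_fin (I : finType) (S : I -> set V) (s : seq I) :
  (forall i, compact_open (S i)) ->
  compact_open [set v | exists2 i, i \in s & S i v].
Proof.
move=> cS; elim: s => [|i s IH].
  rewrite (_ : [set v | _] = set0); first exact: compact_open0.
  by apply: eq_setP => v; split => //= -[].
rewrite (_ : [set v | _] = S i `|` [set v | exists2 i, i \in s & S i v]).
  exact: compact_openU.
apply: eq_setP => v; split => /=.
  by move=> [j]; rewrite inE => /orP[/eqP->|js] Sv; [left|right; exists j].
by move=> [Sv|[j js Sv]]; [exists i|exists j]; rewrite ?inE ?eqxx ?js ?orbT.
Qed.

Lemma fin_union_ind (P : set V -> Prop) (I : finType) (S : I -> set V) :
  P set0 ->
  (forall S T, compact_open S -> compact_open T -> S `&` T = set0 ->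
    P S -> P T -> P (S `|` T)) ->
  (forall i, compact_open (S i)) -> (forall i j v, S i v -> S j v -> i = j) ->
  (forall i, P (S i)) -> P [set v | exists i, S i v].
Proof.
move=> P0 PU cS dS PS.
rewrite (_ : [set v | _] = [set v | exists2 i, i \in enum I & S i v]); last first.
  apply: eq_setP => v; split=> /=; case=> i.
    by exists i; rewrite ?mem_enum.
  by exists i.
elim: (enum I) (enum_uniq I) => [|i s IH] /=.
  move=> _; rewrite (_ : [set v | _] = set0)//.
  by apply: eq_setP => v; split => //= -[].
move=> /andP[nis us].
rewrite (_ : [set v | _] = S i `|` [set v | exists2 i, i \in s & S i v]).
  apply: PU => //; [exact: compact_open_fin | | exact: IH].
  apply: eq_setP => v; split => //= -[Siv [j js Sjv]].
  by move: nis; rewrite (dS _ _ _ Siv Sjv) js.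
apply: eq_setP => v; split => /=.
  by move=> [j]; rewrite inE => /orP[/eqP->|js] Sv; [left|right; exists j].
by move=> [Sv|[j js Sv]]; [exists i|exists j]; rewrite ?inE ?eqxx ?js ?orbT.
Qed.

(** Reduces any statement compatible with disjoint unions to balls; it serves for scaling, tameness,
    measurability, finiteness and translation invariance. *)
Lemma compact_open_ind (P : set V -> Prop) :
  P set0 ->
  (forall S T, compact_open S -> compact_open T -> S `&` T = set0 ->
    P S -> P T -> P (S `|` T)) ->
  (forall c (n : nat), P [set v | nrm (v - c) <= qz (- n%:Z)]) ->
  forall S, compact_open S -> P S.
Proof.
move=> P0 PU PB S0 [n [bS0 pS0]].
have [w hw] := exprz_uniformizer HF.
have [rep [rep1 rep_ex rep_inj]] := residue_reps HF.
pose I := ('I_q * 'I_q * 'I_q * 'I_q)%type.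
pose rep4 (i : I) : V := (rep i.1.1.1, rep i.1.1.2, rep i.1.2, rep i.2).
have rep4_ex v : nrm v <= 1 -> exists i, nrm (v - rep4 i) < 1.
  move=> /nrm_leP[/rep_ex[i1 h1] /rep_ex[i2 h2] /rep_ex[i3 h3] /rep_ex[i4 h4]].
  by exists (i1, i2, i3, i4); apply/nrm_ltP.
have rep4_inj i j : nrm (rep4 i - rep4 j) < 1 -> i = j.
  move: i j => [[[i1 i2] i3] i4] [[[j1 j2] j3] j4] /nrm_ltP/=.
  by move=> [/rep_inj-> /rep_inj-> /rep_inj-> /rep_inj->].
(* The period [qz (- n)] is fixed while [d] measures the size of the ball holding [S]. The bound
   [qz n] on [S] is the case [d = n + n] around 0. *)
suff H (d : nat) (c : V) S : bounded_by n S -> periodic n S ->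
    (forall v, S v -> nrm (v - c) <= qz (d%:Z - n%:Z)) -> P S.
  apply: (H (n + n)%N 0) => // v /bS0; rewrite subr0.
  by rewrite (_ : (n + n)%N%:Z - n%:Z = n%:Z)//; lia.
elim: d c S => [|d IH] c S bS pS hS.
  have [[v0 Sv0]|S_empty] := EM (exists v, S v); last first.
    rewrite (_ : S = set0)//.
    by apply: eq_setP => v; split => // Sv; case: S_empty; exists v.
  (* A nonempty set inside a ball whose radius is its own period is the whole ball. *)
  rewrite (_ : S = [set v | nrm (v - c) <= qz (- n%:Z)]); first exact: PB.
  apply: eq_setP => v; split => /=; first by move/hS; rewrite sub0r.
  move=> h; rewrite -(subrK v0 v) addrC; apply: pS => //.
  rewrite -(subrK c v) -addrA; apply: nrm_add_le => //.
  by rewrite nrm_subC; move/hS: Sv0; rewrite sub0r.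
pose k : int := d.+1%:Z - n%:Z.
pose ctr i := c + smul (w k) (rep4 i).
pose B i := [set v | nrm (v - ctr i) <= qz (d%:Z - n%:Z)].
have kE : k - 1 = d%:Z - n%:Z by rewrite /k; lia.
have wk0 : w k != 0 by rewrite -(absF_eq0 HF) hw (qz_neq0 HF).
rewrite (_ : S = [set v | exists i, (S `&` B i) v]); last first.
  apply: eq_setP => v; split; last by case=> i [].
  move=> Sv; have [|i hi] := rep4_ex (smul (w k)^-1 (v - c)).
    rewrite nrm_smul (absFV HF) hw ler_pdivrMl ?(qz_gt0 HF)// mulr1.
    exact: hS.
  exists i; split=> //; rewrite /B /ctr /= opprD addrA -kE -nrm_lt_qz.
  rewrite (_ : v - c - _ = smul (w k) (smul (w k)^-1 (v - c) - rep4 i)).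
    by rewrite nrm_smul hw -[ltRHS]mulr1 ltr_pM2l// (qz_gt0 HF).
  by rewrite smulBr smulA divff// smul1.
have pB i : periodic n (B i).
  move=> v e /= hv he; rewrite /B /= addrAC; apply: nrm_add_le => //.
  by apply: le_trans he _; rewrite (ler_qz HF); lia.
have pI i : periodic n (S `&` B i).
  by move=> v e [Sv Bv] en; split; [exact: pS|exact: pB].
have bI i : bounded_by n (S `&` B i) by move=> v [/bS].
apply: fin_union_ind => //.
- by move=> i; exists n.
- move=> i j v [_ Bi] [_ Bj]; apply: rep4_inj.
  have : nrm (ctr i - ctr j) <= qz (k - 1).
    rewrite kE (_ : ctr i - ctr j = (v - ctr j) - (v - ctr i)).
      exact: nrm_sub_le.
    by rewrite opprB [RHS]addrC addrA subrK.
  rewrite -nrm_lt_qz /ctr opprD addrACA subrr add0r -smulBr nrm_smul hw.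
  by rewrite -[ltRHS]mulr1 ltr_pM2l// (qz_gt0 HF).
- by move=> i; apply: (IH (ctr i)) => // v [].
Qed.

End CompactOpen.

(** * Finitely additive, translation invariant volumes *)

Section Content.
Context {R : realType} {F : fieldType} {absF : F -> R} {q : nat}.
Hypothesis HF : local_field absF q.
Local Notation V := (F * F * F * F)%type.
Local Notation qz k := (q%:R ^ (k : int) : R).
Local Notation co := (@compact_open R F absF q).
Local Notation nrm := (@nrm R F absF).

Record content (nu : set V -> R) : Prop := Content {
  contentU : forall S T, co S -> co T -> S `&` T = set0 ->
    nu (S `|` T) = nu S + nu T ;
  content_shift : forall S u, co S -> nu [set v | S (v - u)] = nu S }.

Context {nu : set V -> R}.
Hypothesis Hnu : content nu.

Lemma content0 : nu set0 = 0.
Proof.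
have := contentU Hnu (compact_open0 (q := q) (absF := absF)) (compact_open0 (q := q) (absF := absF)).
by rewrite setI0 setU0 => /(_ erefl)/eqP; rewrite eq_sym -subr_eq0 addrK => /eqP.
Qed.

Lemma contentID S T : co S -> co T -> nu S = nu (S `&` T) + nu (S `\` T).
Proof.
move=> cS cT; rewrite -(contentU Hnu); first by rewrite setUIDK.
- exact: compact_openI.
- exact: compact_openD.
- by rewrite setDE setIACA setICr setI0.
Qed.

Lemma contentD S T : co S -> co T -> T `<=` S -> nu (S `\` T) = nu S - nu T.
Proof.
move=> cS cT TS; rewrite (contentID cS cT) (_ : S `&` T = T).
  by rewrite addrC addKr.
by apply: eq_setP => v; split => [[]//|Tv]; split => //; exact: TS.
Qed.

Lemma content_translates (rep : 'I_q -> F) (e : V) S S' : co S' ->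
  (forall v, S v <-> exists i, S' (v - smul (rep i) e)) ->
  (forall v i j, S' (v - smul (rep i) e) -> S' (v - smul (rep j) e) -> i = j) ->
  nu S = q%:R * nu S'.
Proof.
move=> cS' SE inj.
pose T i := [set v | S' (v - smul (rep i) e)].
have cT i : co (T i) by exact: (compact_open_shift HF).
have -> : S = [set v | exists2 i, i \in enum 'I_q & T i v].
  apply: eq_setP => v; split; first by move=> /SE[i Ti]; exists i; rewrite ?mem_enum.
  by case=> i _ Ti; apply/SE; exists i.
suff H (s : seq 'I_q) : uniq s ->
    nu [set v | exists2 i, i \in s & T i v] = (size s)%:R * nu S'.
  by rewrite H ?enum_uniq// size_enum_ord.
elim: s => [|i s IH] /=.
  move=> _; rewrite (_ : [set v | _] = set0) ?content0 ?mul0r//.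
  by apply: eq_setP => v; split => //= -[].
move=> /andP[nis us].
rewrite (_ : [set v | _] = T i `|` [set v | exists2 i, i \in s & T i v]).
  rewrite (contentU Hnu)//; first by rewrite IH// (content_shift Hnu)// mulrS mulrDl mul1r.
    exact: compact_open_fin.
  apply: eq_setP => v; split => //= -[Siv [j js Sjv]].
  by move: nis; rewrite (inj _ _ _ Siv Sjv) js.
apply: eq_setP => v; split => /=.
  by move=> [j]; rewrite inE => /orP[/eqP->|js] Sv; [left|right; exists j].
by move=> [Sv|[j js Sv]]; [exists i|exists j]; rewrite ?inE ?eqxx ?js ?orbT.
Qed.

(* Along the line v + F e the function f is affine with slope of
   constant absolute value, so translating by residue representatives spreads
   the finer level set over the coarser one. *)
Lemma content_affine_level (f l : V -> F) (e : V) (U : set V) (j m : int) :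
  (forall v x, U v -> f (v + smul x e) = f v + x * l v) ->
  (forall v, U v -> absF (l v) = qz j) ->
  (forall v x, U v -> absF x <= qz (- m - j) -> U (v + smul x e)) ->
  co (U `&` [set v | absF (f v) <= qz (- (m + 1))]) ->
  nu (U `&` [set v | absF (f v) <= qz (- m)]) =
    q%:R * nu (U `&` [set v | absF (f v) <= qz (- (m + 1))]).
Proof.
move=> fe lj Ue cU.
have [w hw] := exprz_uniformizer HF.
have [rep [rep1 rep_ex rep_inj]] := residue_reps HF.
(* Chosen so that [x0 * l v] has absolute value [qz (- m)]: the translates by [rep i * x0] then run
   through all residues of [f v] at level [m]. *)
pose x0 := w (- m - j).
have smE i v : v - smul (rep i) (smul x0 e) = v + smul (- (rep i * x0)) e.
  by congr (_ + _); rewrite /smul/= !mulNr !mulrA.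
have xi i : absF (- (rep i * x0)) <= qz (- m - j).
  by rewrite (absFN HF) (absFM HF) hw ler_piMl// ltW// (qz_gt0 HF).
have xi' i : absF (rep i * x0) <= qz (- m - j) by rewrite -(absFN HF).
have lx v : U v -> absF (x0 * l v) = qz (- m).
  by move=> Uv; rewrite (absFM HF) hw lj// -(qzD HF) subrK.
have back v i : U (v - smul (rep i) (smul x0 e)) -> U v.
  move=> h; rewrite -(subrK (smul (rep i) (smul x0 e)) v) smulA.
  by move: h; rewrite smulA => h; exact: Ue.
apply: (content_translates (rep := rep) (e := smul x0 e)) => //.
- move=> v; split.
    move=> [Uv fv].
    have l0 : x0 * l v != 0 by rewrite -(absF_eq0 HF) lx// (qz_neq0 HF).
    have [|i hi] := rep_ex (f v / (x0 * l v)).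
      by rewrite (absF_div HF) lx// ler_pdivrMr ?(qz_gt0 HF)// mul1r.
    exists i; rewrite smE; split; first exact: Ue.
    rewrite /= fe// (_ : - (m + 1) = - m - 1) ?opprD// -(absF_lt_qz HF).
    rewrite (_ : f v + _ = (x0 * l v) * (f v / (x0 * l v) - rep i)).
      by rewrite (absFM HF) lx// -[ltRHS]mulr1 ltr_pM2l// (qz_gt0 HF).
    by rewrite mulrBr mulrCA divff// mulr1; ring.
  move=> [i [hU hf]]; have Uv := back _ _ hU.
  split => //=; move: hf; rewrite smE /= fe// => hf.
  rewrite (_ : f v = (f v + - (rep i * x0) * l v) + rep i * (x0 * l v)); last by ring.
  apply: (absF_add_le HF); first by apply: le_trans hf _; rewrite (ler_qz HF); lia.
  by rewrite (absFM HF) lx// ler_piMl// ltW// (qz_gt0 HF).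
- move=> v i k [hU hi] [_ hk]; have Uv := back _ _ hU.
  move: hi hk; rewrite !smE /= !fe// => hi hk; apply: rep_inj.
  rewrite -(ltr_pM2l (qz_gt0 HF (- m))) mulr1 -(lx v Uv) -(absFM HF) (lx v Uv).
  rewrite (absF_lt_qz HF).
  rewrite (_ : _ * _ = (f v + - (rep k * x0) * l v) - (f v + - (rep i * x0) * l v)).
    by apply: (absF_sub_le HF); rewrite -opprD.
  by ring.
Qed.

Definition box (i j k l : int) : set V :=
  [set v | [/\ absF v.1.1.1 <= qz (- i), absF v.1.1.2 <= qz (- j),
               absF v.1.2 <= qz (- k) & absF v.2 <= qz (- l)]].

Lemma compact_open_box i j k l : co (box i j k l).
Proof.
have [N [[h1 h2] [h3 h4] [h5 h6] [h7 h8]]] : exists N : nat,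
    [/\ - i <= N%:Z /\ - N%:Z <= - i, - j <= N%:Z /\ - N%:Z <= - j,
        - k <= N%:Z /\ - N%:Z <= - k & - l <= N%:Z /\ - N%:Z <= - l].
  by exists (`|i| + `|j| + `|k| + `|l|)%N; split; lia.
have W (x : F) (m m' : int) : m <= m' -> absF x <= qz m -> absF x <= qz m'.
  by move=> mn h; apply: le_trans h _; rewrite (ler_qz HF).
exists N; split.
  move=> v [v1 v2 v3 v4]; apply/nrm_leP; split.
  - exact: W v1.
  - exact: W v2.
  - exact: W v3.
  - exact: W v4.
move=> v e [v1 v2 v3 v4] /nrm_leP[e1 e2 e3 e4].
split; apply: (absF_add_le HF) => //.
- exact: W e1.
- exact: W e2.
- exact: W e3.
- exact: W e4.
Qed.

Lemma content_box_step i j k l :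
  [/\ nu (box i j k l) = q%:R * nu (box (i + 1) j k l),
      nu (box i j k l) = q%:R * nu (box i (j + 1) k l),
      nu (box i j k l) = q%:R * nu (box i j (k + 1) l) &
      nu (box i j k l) = q%:R * nu (box i j k (l + 1))].
Proof.
split.
- have := @content_affine_level (fun v => v.1.1.1) (fun=> 1) (1, 0, 0, 0)
    [set v | [/\ absF v.1.1.2 <= qz (- j), absF v.1.2 <= qz (- k)
             & absF v.2 <= qz (- l)]] 0 i.
  have E m : [set v | [/\ absF v.1.1.2 <= qz (- j), absF v.1.2 <= qz (- k)
      & absF v.2 <= qz (- l)]] `&` [set v : V | absF v.1.1.1 <= qz (- m)]
      = box m j k l by apply: eq_setP => v; split; [case=> -[]|case].
  rewrite !E; apply => //.
  + by move=> v; rewrite (absF1 HF) expr0z.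
  + by move=> v x /= [h1 h2 h3] _; rewrite !mulr0 !addr0.
  + exact: compact_open_box.
- have := @content_affine_level (fun v => v.1.1.2) (fun=> 1) (0, 1, 0, 0)
    [set v | [/\ absF v.1.1.1 <= qz (- i), absF v.1.2 <= qz (- k)
             & absF v.2 <= qz (- l)]] 0 j.
  have E m : [set v | [/\ absF v.1.1.1 <= qz (- i), absF v.1.2 <= qz (- k)
      & absF v.2 <= qz (- l)]] `&` [set v : V | absF v.1.1.2 <= qz (- m)]
      = box i m k l by apply: eq_setP => v; split; [case=> -[]|case].
  rewrite !E; apply => //.
  + by move=> v; rewrite (absF1 HF) expr0z.
  + by move=> v x /= [h1 h2 h3] _; rewrite !mulr0 !addr0.
  + exact: compact_open_box.
- have := @content_affine_level (fun v => v.1.2) (fun=> 1) (0, 0, 1, 0)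
    [set v | [/\ absF v.1.1.1 <= qz (- i), absF v.1.1.2 <= qz (- j)
             & absF v.2 <= qz (- l)]] 0 k.
  have E m : [set v | [/\ absF v.1.1.1 <= qz (- i), absF v.1.1.2 <= qz (- j)
      & absF v.2 <= qz (- l)]] `&` [set v : V | absF v.1.2 <= qz (- m)]
      = box i j m l by apply: eq_setP => v; split; [case=> -[]|case].
  rewrite !E; apply => //.
  + by move=> v; rewrite (absF1 HF) expr0z.
  + by move=> v x /= [h1 h2 h3] _; rewrite !mulr0 !addr0.
  + exact: compact_open_box.
- have := @content_affine_level (fun v => v.2) (fun=> 1) (0, 0, 0, 1)
    [set v | [/\ absF v.1.1.1 <= qz (- i), absF v.1.1.2 <= qz (- j)
             & absF v.1.2 <= qz (- k)]] 0 l.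
  have E m : [set v | [/\ absF v.1.1.1 <= qz (- i), absF v.1.1.2 <= qz (- j)
      & absF v.1.2 <= qz (- k)]] `&` [set v : V | absF v.2 <= qz (- m)]
      = box i j k m by apply: eq_setP => v; split; [case=> -[]|case].
  rewrite !E; apply => //.
  + by move=> v; rewrite (absF1 HF) expr0z.
  + by move=> v x /= [h1 h2 h3] _; rewrite !mulr0 !addr0.
  + exact: compact_open_box.
Qed.

Lemma content_ball_step (n : int) :
  nu [set v | nrm v <= qz (- n)] = qz 4 * nu [set v | nrm v <= qz (- (n + 1))].
Proof.
have E m : [set v | nrm v <= qz (- m)] = box m m m m.
  by apply: eq_setP => v; split => [/nrm_leP|h]; [|apply/nrm_leP].
rewrite !E; have [-> _ _ _] := content_box_step n n n n.
have [_ -> _ _] := content_box_step (n + 1) n n n.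
have [_ _ -> _] := content_box_step (n + 1) (n + 1) n n.
have [_ _ _ ->] := content_box_step (n + 1) (n + 1) (n + 1) n.
by rewrite -exprnP; ring.
Qed.

Lemma content_scale c S : absF c = q%:R -> co S ->
  nu [set v | S (smul c v)] = qz (- 4) * nu S.
Proof.
move=> ac; have c0 : c != 0 by rewrite -(absF_eq0 HF) ac (qR_neq0 HF).
have q0 := qR_gt0 HF.
move: S; apply: (compact_open_ind HF).
- by rewrite content0 mulr0.
- move=> S T cS cT ST IS IT.
  rewrite (contentU Hnu)// mulrDr -IS -IT -(contentU Hnu) //.
  + exact: (compact_open_smul HF).
  + exact: (compact_open_smul HF).
  + apply: eq_setP => v; split => // -[h1 h2].
    have : (S `&` T) (smul c v) by [].
    by rewrite ST.
- move=> u n.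
  rewrite (content_shift Hnu (S := [set v | nrm v <= qz (- n%:Z)])); last first.
    exact: (compact_open_ball0 HF).
  rewrite [X in nu X = _](_ : _ = [set v | [set v | nrm v <= qz (- (n%:Z + 1))] (v - smul c^-1 u)]).
    transitivity (nu [set v | nrm v <= qz (- (n%:Z + 1))]).
      exact: (content_shift Hnu _ (compact_open_ball0 HF _)).
    by rewrite (content_ball_step n%:Z) mulrA -(qzD HF) addNr expr0z mul1r.
  apply: eq_setP => v /=.
  have -> : smul c v - u = smul c (v - smul c^-1 u).
    by rewrite smulBr smulA divff// smul1.
  by rewrite (nrm_smul HF) ac opprD (qzD HF) exprN1 ler_pdivlMr// mulrC.
Qed.

End Content.

(** * Regularized integrals of the normal form *)

Section NormalForm.
Context {R : realType} {F : fieldType} {absF : F -> R} {q : nat}.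
Hypothesis HF : local_field absF q.
Local Notation V := (F * F * F * F)%type.
Local Notation qz k := (q%:R ^ (k : int) : R).
Local Notation co := (@compact_open R F absF q).
Local Notation nrm := (@nrm R F absF).
Context {nu : set V -> R}.
Hypothesis Hnu : @content R F absF q nu.
Context {A : F}.
Hypothesis A_le1 : absF A <= 1.
(** The [- 1] is the loss in the ramified case: for [z = 0] and [absF A = q%:R^-1] the bound is
    attained. *)
Hypothesis aniso : forall z t (k : int), qz k <= absF z \/ qz k <= absF t ->
  qz (k + k - 1) <= absF (z ^+ 2 - A * t ^+ 2).

Definition normal_form (v : V) : F :=
  v.1.1.1 * v.1.1.2 + (v.1.2 ^+ 2 - A * v.2 ^+ 2).
Local Notation Q := normal_form.

Definition level (U : set V) (m : int) := U `&` [set v | absF (Q v) <= qz (- m)].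

(** Let N k be the volume of the part of [U] where |Q| = q^-k. This is the term (N k - q N (k + 1))
    T^k of the product of 1 - q / T with the series of the N k T^k, taken at T = q^2. *)
Definition weight (U : set V) (k : int) : R :=
  (nu (level U k) - nu (level U (k + 1))
   - q%:R * (nu (level U (k + 1)) - nu (level U (k + 1 + 1)))) * qz (k + k).

(* Up to the factor 1 - q^-1, the value at s = 0 of the continuation of the
   integral of |Q|^(2(s-1)) over U: multiplying a power series in T by 1 - q / T
   turns a geometric tail of ratio 1 / q into a finite sum. *)
Definition total_weight (U : set V) : R := \sum_(k \in [set: int]) weight U k.

(** Guards [total_weight], whose sum over all integers falls back to the default value 0 when
    infinitely many terms are nonzero. *)
Definition tame (U : set V) := exists K : nat,
  forall k : int, k < - K%:Z \/ K%:Z <= k -> weight U k = 0.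

Lemma absF_mul_le x y (i j : int) :
  absF x <= qz i -> absF y <= qz j -> absF (x * y) <= qz (i + j).
Proof.
by move=> xi yj; rewrite (absFM HF) (qzD HF) ler_pM ?(absF_ge0 HF).
Qed.

Lemma normal_form_diff v e (n N : nat) : nrm v <= qz n -> nrm e <= qz (- N%:Z) ->
  absF (Q (v + e) - Q v) <= qz (n%:Z - N%:Z).
Proof.
have NN : - N%:Z + - N%:Z <= n%:Z - N%:Z by lia.
have Nn : - N%:Z + n%:Z <= n%:Z - N%:Z by lia.
move=> /nrm_leP[v1 v2 v3 v4] /nrm_leP[e1 e2 e3 e4].
have -> : Q (v + e) - Q v = v.1.1.1 * e.1.1.2 + e.1.1.1 * v.1.1.2
   + e.1.1.1 * e.1.1.2 + (2 * (v.1.2 * e.1.2) + e.1.2 * e.1.2)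
   - A * (2 * (v.2 * e.2) + e.2 * e.2) by rewrite /Q /=; ring.
have W (x : F) (m : int) : m <= n%:Z - N%:Z -> absF x <= qz m ->
    absF x <= qz (n%:Z - N%:Z).
  by move=> mn h; apply: le_trans h _; rewrite (ler_qz HF).
have D2 x : absF x <= qz (n%:Z - N%:Z) -> absF (2 * x) <= qz (n%:Z - N%:Z).
  move=> h; rewrite (absFM HF); apply: le_trans h.
  by rewrite ler_piMl ?(absF_ge0 HF)// (absF_nat_le1 HF 2).
have ZA x : absF x <= qz (n%:Z - N%:Z) -> absF (A * x) <= qz (n%:Z - N%:Z).
  move=> h; rewrite (absFM HF); apply: le_trans h.
  by rewrite ler_piMl ?(absF_ge0 HF).
apply: (absF_sub_le HF); last apply: ZA; repeat apply: (absF_add_le HF);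
  rewrite ?D2//; by [exact: absF_mul_le | apply: W NN _; exact: absF_mul_le
    | apply: W Nn _; exact: absF_mul_le].
Qed.

Lemma compact_open_level U m : co U -> co (level U m).
Proof.
move=> [n [bU pU]]; apply: (@compact_openP _ _ _ _ HF n (n + `|m|)%N).
  by move=> v [/bU].
move=> v e [Uv Qv] he; split.
  by apply: pU => //; apply: le_trans he _; rewrite (ler_qz HF); lia.
rewrite /= -(subrK (Q v) (Q (v + e))); apply: (absF_add_le HF) => //.
apply: le_trans (normal_form_diff (bU _ Uv) he) _.
by rewrite (ler_qz HF); lia.
Qed.

Lemma level_low U : co U -> exists M : nat, forall m : int, m <= - M%:Z ->
  level U m = U.
Proof.
move=> [n [bU pU]]; exists (n + n)%N => m mM; apply: eq_setP => v.
split; [by case|move=> Uv; split => //=].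
apply: le_trans (_ : qz (n%:Z + n%:Z) <= _); last by rewrite (ler_qz HF); lia.
have /nrm_leP[v1 v2 v3 v4] := bU _ Uv.
apply: (absF_add_le HF); first exact: absF_mul_le.
apply: (absF_sub_le HF); first exact: absF_mul_le.
rewrite (absFM HF); apply: le_trans (_ : absF (v.2 ^+ 2) <= _).
  by rewrite ler_piMl ?(absF_ge0 HF).
exact: absF_mul_le.
Qed.

Lemma content_level_shift U (f g : V -> F) (e : V) (j m : int) :
  (forall v x, Q (v + smul x e) = Q v + x * g v) ->
  (forall v, U v -> absF (g v) = qz j) ->
  (forall v x, U v -> absF x <= qz (- m - j) -> U (v + smul x e)) -> co U ->
  nu (level U m) = q%:R * nu (level U (m + 1)).
Proof.
move=> h1 h2 h3 cU.
apply: (content_affine_level HF Hnu (l := g) (e := e) (j := j)) => //.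
exact: compact_open_level.
Qed.

Lemma tame_of_tail U : co U ->
  (exists m0 : int, forall m : int, m0 <= m ->
     nu (level U m) = q%:R * nu (level U (m + 1))) -> tame U.
Proof.
move=> cU [m0 h]; have [M hM] := level_low cU.
(* The margin 2 is the reach of [weight U k], which involves levels up to [k + 1 + 1]. *)
exists (M + 2 + `|m0|)%N => k [hk|hk]; rewrite /weight.
  by rewrite !hM ?subrr ?mulr0 ?subr0 ?mul0r//; lia.
rewrite h; last by lia.
by rewrite (h (k + 1)); last lia; rewrite -mulrBr subrr mul0r.
Qed.

Lemma levelU S T m : level (S `|` T) m = level S m `|` level T m.
Proof. exact: setIUl. Qed.

Lemma weightU S T k : co S -> co T -> S `&` T = set0 ->
  weight (S `|` T) k = weight S k + weight T k.
Proof.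
move=> cS cT ST; rewrite /weight.
have E m : nu (level (S `|` T) m) = nu (level S m) + nu (level T m).
  rewrite levelU (contentU Hnu)//; try exact: compact_open_level.
  by rewrite /level setIACA ST set0I.
by rewrite !E; ring.
Qed.

(** On a ball avoiding 0, if the first or the second coordinate of the centre exceeds the radius,
    then [Q] is affine in the other one with slope of constant absolute value, and the levels
    eventually shrink by the factor [q]. Otherwise the product of these coordinates is too small to
    cancel the anisotropic part, and high levels are empty. *)
Lemma tame_punctured U : co U -> ~ U 0 -> tame U.
Proof.
move: U; apply: (compact_open_ind HF).
- move=> _; exists 0%N => k _; rewrite /weight /level !set0I (content0 Hnu).
  by rewrite !subrr mulr0 subrr mul0r.
- move=> S T cS cT ST IS IT n0.
  have [|K hK] := IS; first by move=> S0; apply: n0; left.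
  have [|L hL] := IT; first by move=> T0; apply: n0; right.
  exists (K + L)%N => k hk; rewrite weightU// hK ?hL ?addr0//; lia.
move=> c n /=.
have lt1 : - n%:Z + - n%:Z < (- n%:Z + 1) + (- n%:Z + 1) - 1 by lia.
have le1 (k : int) : n%:Z + n%:Z <= k -> - k <= - n%:Z + - n%:Z by lia.
rewrite sub0r (nrm_opp HF) => /negP; rewrite -ltNge => hc.
have cB : co [set v | nrm (v - c) <= qz (- n%:Z)] 
  by exact: (compact_open_shift HF c (compact_open_ball0 HF _)).
have stab (e : V) (j m : int) v x : nrm e <= 1 -> n%:Z - j <= m ->
    nrm (v - c) <= qz (- n%:Z) -> absF x <= qz (- m - j) ->
    nrm (v + smul x e - c) <= qz (- n%:Z).
  move=> e1 mj vc xm; rewrite addrAC; apply: (nrm_add_le HF) => //.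
  rewrite (nrm_smul HF); apply: le_trans (_ : qz (- m - j) * 1 <= _).
    by apply: ler_pM; rewrite ?(absF_ge0 HF) ?(nrm_ge0 HF).
  by rewrite mulr1 (ler_qz HF); lia.
have [ca|ca] := ltP (qz (- n%:Z)) (absF c.1.1.1).
  have /(absF_discrete HF)[j hj] : c.1.1.1 != 0.
    by rewrite -(absF_gt0 HF); apply: lt_trans ca; exact: (qz_gt0 HF).
  apply: tame_of_tail => //; exists (n%:Z - j) => m hm.
  apply: (@content_level_shift _ Q (fun v => v.1.1.1) (0, 1, 0, 0) j) => //.
  + by move=> v x; rewrite /Q /=; ring.
  + move=> v /= /nrm_leP[h _ _ _]; rewrite -hj.
    apply: (absF_close HF) (lexx _); exact: le_lt_trans h ca.
  + move=> v x /= hv hx; apply: stab hm hv hx; apply/nrm_leP.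
    by split; rewrite /= ?(absF0 HF) ?(absF1 HF).
have [cb|cb] := ltP (qz (- n%:Z)) (absF c.1.1.2).
  have /(absF_discrete HF)[j hj] : c.1.1.2 != 0.
    by rewrite -(absF_gt0 HF); apply: lt_trans cb; exact: (qz_gt0 HF).
  apply: tame_of_tail => //; exists (n%:Z - j) => m hm.
  apply: (@content_level_shift _ Q (fun v => v.1.1.2) (1, 0, 0, 0) j) => //.
  + by move=> v x; rewrite /Q /=; ring.
  + move=> v /= /nrm_leP[_ h _ _]; rewrite -hj.
    apply: (absF_close HF) (lexx _); exact: le_lt_trans h cb.
  + move=> v x /= hv hx; apply: stab hm hv hx; apply/nrm_leP.
    by split; rewrite /= ?(absF0 HF) ?(absF1 HF).
apply: tame_of_tail => //; exists (n%:Z + n%:Z) => m hm.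
suff E k : n%:Z + n%:Z <= k -> level [set v | nrm (v - c) <= qz (- n%:Z)] k = set0.
  by rewrite !E ?(content0 Hnu) ?mulr0//; lia.
move=> hk; apply: eq_setP => v; split => // -[/nrm_leP[h1 h2 h3 h4] /= Qv].
have va : absF v.1.1.1 <= qz (- n%:Z).
  by rewrite -(subrK c.1.1.1 v.1.1.1); exact: (absF_add_le HF).
have vb : absF v.1.1.2 <= qz (- n%:Z).
  by rewrite -(subrK c.1.1.2 v.1.1.2); exact: (absF_add_le HF).
(* Values being discrete, exceeding the radius means reaching at least [q] times the radius;
   squared, this outweighs the [- 1] in [aniso]. *)
have far (x y : F) : absF (x - y) <= qz (- n%:Z) -> qz (- n%:Z) < absF y ->
    qz (- n%:Z + 1) <= absF x.
  move=> xy hy; rewrite (absF_close HF (y := y) (c := absF y))//; last exact: le_lt_trans xy hy.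
  by rewrite leNgt (absF_lt_qz HF) addrK -ltNge.
have zt : qz (- n%:Z + 1) <= absF v.1.2 \/ qz (- n%:Z + 1) <= absF v.2.
  move: hc; rewrite /nrm !lt_max !ltNge ca cb/= -!ltNge => /orP[h|h].
    by left; apply: far h3 h.
  by right; apply: far h4 h.
have := aniso zt; apply/negP; rewrite -ltNge.
apply: le_lt_trans (_ : qz (- n%:Z + - n%:Z) < _); last by rewrite (ltr_qz HF).
rewrite (_ : _ - _ = Q v - v.1.1.1 * v.1.1.2); last by rewrite /Q; ring.
apply: (absF_sub_le HF); last exact: absF_mul_le.
by apply: le_trans Qv _; rewrite (ler_qz HF); exact: le1.
Qed.

Definition window (K : nat) : seq int := [seq i%:Z - K%:Z | i <- iota 0 (K + K)].

Lemma mem_window K (k : int) : (k \in window K) = (- K%:Z <= k) && (k < K%:Z).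
Proof.
apply/mapP/andP => [[j]|[h1 h2]].
  by rewrite mem_iota => hj ->; split; lia.
by exists (absz (k + K%:Z)); rewrite ?mem_iota; lia.
Qed.

Lemma window_uniq K : uniq (window K).
Proof. by rewrite map_inj_uniq ?iota_uniq// => i j; lia. Qed.

Lemma total_weight_window U (K : nat) :
  (forall k : int, k < - K%:Z \/ K%:Z <= k -> weight U k = 0) ->
  total_weight U = \sum_(k <- window K) weight U k.
Proof.
move=> h; rewrite /total_weight (fsbigE (window K)) ?window_uniq//.
  by apply: eq_bigl => k; exact: in_setT.
move=> k _; rewrite mem_window => hk; apply: h; lia.
Qed.

Lemma total_weightU S T : co S -> co T -> S `&` T = set0 -> tame S -> tame T ->
  total_weight (S `|` T) = total_weight S + total_weight T.
Proof.
move=> cS cT ST [K hK] [L hL].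
have hS k : k < - (K + L)%N%:Z \/ (K + L)%N%:Z <= k -> weight S k = 0.
  by move=> hk; apply: hK; lia.
have hT k : k < - (K + L)%N%:Z \/ (K + L)%N%:Z <= k -> weight T k = 0.
  by move=> hk; apply: hL; lia.
rewrite (total_weight_window hS) (total_weight_window hT) -big_split/=.
rewrite (@total_weight_window _ (K + L)).
  by apply: eq_bigr => k _; exact: weightU.
by move=> k hk; rewrite weightU// hS// hT// addr0.
Qed.

(** A degree count: the volume contributes [qz (- 4)], the quadratic form shifts levels by 2, and
    this shift changes [qz (k + k)] by the same [qz (- 4)]. *)
Lemma total_weight_scale U c : absF c = q%:R -> co U ->
  total_weight [set v | U (smul c v)] = total_weight U.
Proof.
move=> ac cU.
have E m : nu (level [set v | U (smul c v)] m) = qz (- 4) * nu (level U (m - 2)).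
  rewrite -(content_scale HF Hnu ac); last exact: compact_open_level.
  congr (nu _); apply: eq_setP => v; rewrite /level /=.
  have -> : Q (smul c v) = c ^+ 2 * Q v by rewrite /Q /=; ring.
  rewrite (absFM HF) (absFX HF) ac opprB (qzD HF) -exprnP.
  by rewrite ler_pM2l// exprn_gt0// (qR_gt0 HF).
rewrite /total_weight [RHS](reindex_fsbigT (fun k : int => k - 2)).
  apply: eq_fsbigr => k _; rewrite /weight !E.
  have -> : k + 1 - 2 = k - 2 + 1 by ring.
  have -> : k + 1 + 1 - 2 = k - 2 + 1 + 1 by ring.
  have -> : k - 2 + (k - 2) = - 4 + (k + k) by ring.
  by rewrite (qzD HF (- 4)); ring.
by exists (fun k => k + 2) => k; rewrite ?addrK ?subrK.
Qed.

Lemma total_weight1 U k0 : (forall k, k != k0 -> weight U k = 0) ->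
  total_weight U = weight U k0.
Proof.
move=> h; rewrite /total_weight (fsbigE [:: k0])//=.
  by rewrite big_cons big_nil in_setT addr0.
by move=> k _; rewrite inE; exact: h.
Qed.

(** The level volumes are constant up to [m1] and decrease geometrically afterwards, so only the
    weight at [m1 - 1], just before the progression starts, survives. Only its subtracted half is
    nonzero, whence the minus sign. *)
Lemma total_weight_unit_slope U (g : V -> F) (e : V) (m1 : int) : co U ->
  (forall v x, Q (v + smul x e) = Q v + x * g v) ->
  (forall v, U v -> absF (g v) = 1) ->
  (forall v x, U v -> absF x <= qz (- m1) -> U (v + smul x e)) ->
  (forall v, U v -> absF (Q v) <= qz (- m1)) ->
  total_weight U = - q%:R^-1 * (1 - q%:R^-1) * qz (m1 + m1) * nu U.
Proof.
move=> cU h1 h2 h3 h4.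
have tail m : m1 <= m -> nu (level U m) = q%:R * nu (level U (m + 1)).
  move=> hm; apply: (@content_level_shift _ Q g e 0) => //.
  move=> v x Uv hx; apply: h3 => //; apply: le_trans hx _.
  by rewrite (ler_qz HF); lia.
have low m : m <= m1 -> level U m = U.
  move=> hm; apply: eq_setP => v; split; [by case|move=> Uv; split => //=].
  by apply: le_trans (h4 v Uv) _; rewrite (ler_qz HF) lerN2.
rewrite (@total_weight1 _ (m1 - 1)) /weight.
  rewrite subrK (low (m1 - 1)); last by lia.
  have := tail m1 (lexx _); rewrite low ?lexx// => e1.
  have -> : m1 - 1 + (m1 - 1) = (m1 + m1) + (- 1) + (- 1) by ring.
  rewrite !(qzD HF) exprN1 e1; have := qR_neq0 HF; move: (q%:R) => y y0.
  by field.
move=> k hk; have [hk1|hk1] := leP k (m1 - 1).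
  have [low1 low2] : k <= m1 /\ k + 1 <= m1 by lia.
  rewrite (low k)// (low (k + 1))//.
  have [hk2|hk2] := eqVneq (k + 1) m1; first by move: hk; rewrite -hk2 addrK eqxx.
  rewrite low; last by lia.
  by rewrite subrr mulr0 subr0 mul0r.
rewrite tail; last by lia.
by rewrite (tail (k + 1)); last lia; rewrite -mulrBr subrr mul0r.
Qed.

(** All the volume sits at the single value [qz (- m1)]. It is counted positively at [m1] and, with
    factor [- q], at [m1 - 1]; the ratio of the two terms is [- q%:R^-1]. *)
Lemma total_weight_const U (m1 : int) : (forall v, U v -> absF (Q v) = qz (- m1)) ->
  total_weight U = (1 - q%:R^-1) * qz (m1 + m1) * nu U.
Proof.
move=> h.
have low m : m <= m1 -> level U m = U.
  move=> hm; apply: eq_setP => v; split; [by case|move=> Uv; split => //=].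
  by rewrite h// (ler_qz HF) lerN2.
have high m : m1 < m -> level U m = set0.
  move=> hm; apply: eq_setP => v; split => // -[Uv /=].
  by rewrite h// (ler_qz HF) lerN2 leNgt hm.
have sum2 : (weight U (m1 - 1) + weight U m1 =
    (1 - q%:R^-1) * qz (m1 + m1) * nu U).
  rewrite /weight subrK (low (m1 - 1)); last by lia.
  rewrite (low m1) // (high (m1 + 1)); last by lia.
  rewrite (high (m1 + 1 + 1)); last by lia.
  have -> : m1 - 1 + (m1 - 1) = (m1 + m1) + (- 1) + (- 1) by ring.
  rewrite !(qzD HF) exprN1 (content0 Hnu).
  by have := qR_neq0 HF; move: (q%:R) => y y0; field.
rewrite -sum2 /total_weight (fsbigE [:: m1 - 1; m1])/=.
- by rewrite !big_cons big_nil !in_setT addr0.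
- by rewrite inE andbT; apply/eqP; lia.
- by [].
move=> k _; rewrite !inE negb_or /weight => /andP[/eqP k1 /eqP k2].
have [hk|hk] := ltP k m1.
  have [low1 [low2 low3]] : k <= m1 /\ k + 1 <= m1 /\ k + 1 + 1 <= m1 by lia.
  by rewrite !low// subrr mulr0 subr0 mul0r.
have [high1 [high2 high3]] : m1 < k /\ m1 < k + 1 /\ m1 < k + 1 + 1 by lia.
by rewrite !high// subrr mulr0 subrr mul0r.
Qed.

End NormalForm.

(** * Independence of the lattice and cancellation for the unit box *)

Section FundamentalDomain.
Context {R : realType} {F : fieldType} {absF : F -> R} {q : nat}.
Hypothesis HF : local_field absF q.
Local Notation V := (F * F * F * F)%type.
Local Notation qz k := (q%:R ^ (k : int) : R).
Local Notation co := (@compact_open R F absF q).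
Local Notation box := (@box R F absF q).
Context {nu : set V -> R}.
Hypothesis Hnu : @content R F absF q nu.
Context {A : F}.
Hypothesis A_le1 : absF A <= 1.
Hypothesis aniso : forall z t (k : int), qz k <= absF z \/ qz k <= absF t ->
  qz (k + k - 1) <= absF (z ^+ 2 - A * t ^+ 2).
Local Notation tw := (@total_weight R F absF q nu A).
Local Notation Q := (@normal_form F A).

(** Both pieces avoid 0 because [U], and hence [T], contains it; they are therefore tame and their
    total weights add. *)
Lemma total_weight_chain (S T U : set V) : co S -> co T -> co U ->
  T `<=` S -> U `<=` T -> U 0 ->
  tw (S `\` U) = tw (S `\` T) + tw (T `\` U).
Proof.
move=> cS cT cU TS UT U0.
have cST : co (S `\` T) by exact: compact_openD.
have cTU : co (T `\` U) by exact: compact_openD.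
rewrite -(total_weightU HF Hnu A_le1) //.
- congr tw; apply: eq_setP => v; split => [[Sv nU]|[[Sv nT]|[Tv nU]]].
  + by have [Tv|nT] := EM (T v); [right|left].
  + by split=> // /UT.
  + by split=> //; exact: TS.
- by apply: eq_setP => v; split => // -[[_ h1] [h2 _]].
- apply: (tame_punctured HF Hnu A_le1 aniso) => // -[_]; apply; exact: UT.
- by apply: (tame_punctured HF Hnu A_le1 aniso) => // -[_]; apply.
Qed.

(* Both sides compute L minus c^-1 L1 up to a piece L minus L1 and its
   translate under the scaling, which have the same weight. *)
Lemma total_weight_fundamental_domain (c : F) (L L1 : set V) : absF c = q%:R ->
  co L -> co L1 -> L1 `<=` L -> L1 0 ->
  [set v | L (smul c v)] `<=` L -> [set v | L1 (smul c v)] `<=` L1 ->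
  tw (L `\` [set v | L (smul c v)]) = tw (L1 `\` [set v | L1 (smul c v)]).
Proof.
move=> ac cL cL1 L1L L10 scL scL1.
have c0 : c != 0 by rewrite -(absF_eq0 HF) ac (qR_neq0 HF).
have csL : co [set v | L (smul c v)] by exact: (compact_open_smul HF).
have csL1 : co [set v | L1 (smul c v)] by exact: (compact_open_smul HF).
have sL10 : L1 (smul c 0) by rewrite smul0.
apply: (@addIr _ (tw (L `\` L1))); rewrite [RHS]addrC.
rewrite -(total_weight_chain cL cL1 csL1)//.
rewrite (total_weight_chain cL csL csL1) //; last by move=> v /L1L.
congr (_ + _); symmetry.
rewrite -[RHS](total_weight_scale HF Hnu A_le1 ac)//.
exact: compact_openD.
Qed.

(** Boolean indices, coerced to the exponents 0 and 1, cover all boxes of the computation. *)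
Lemma content_box_unit (i j k l : bool) :
  nu (box i j k l) = q%:R^-1 ^+ (i + j + k + l) * nu (box 0 0 0 0).
Proof.
have q0 := qR_neq0 HF.
have [s1 _ _ _] := content_box_step HF Hnu 0 0 0 0.
have h1 : nu (box i 0 0 0) = q%:R^-1 ^+ i * nu (box 0 0 0 0).
  by case: i; rewrite ?expr1 ?expr0 ?mul1r// [in RHS]s1 mulKf.
have [_ s2 _ _] := content_box_step HF Hnu i 0 0 0.
have h2 : nu (box i j 0 0) = q%:R^-1 ^+ j * nu (box i 0 0 0).
  by case: j; rewrite ?expr1 ?expr0 ?mul1r// [in RHS]s2 mulKf.
have [_ _ s3 _] := content_box_step HF Hnu i j 0 0.
have h3 : nu (box i j k 0) = q%:R^-1 ^+ k * nu (box i j 0 0).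
  by case: k; rewrite ?expr1 ?expr0 ?mul1r// [in RHS]s3 mulKf.
have [_ _ _ s4] := content_box_step HF Hnu i j k 0.
have h4 : nu (box i j k l) = q%:R^-1 ^+ l * nu (box i j k 0).
  by case: l; rewrite ?expr1 ?expr0 ?mul1r// [in RHS]s4 mulKf.
by rewrite h4 h3 h2 h1 !mulrA -!exprD; congr (_ ^+ _ * _); lia.
Qed.

Lemma box_subset (i j k l i' j' k' l' : int) :
  i' <= i -> j' <= j -> k' <= k -> l' <= l -> box i j k l `<=` box i' j' k' l'.
Proof.
move=> hi hj hk hl v [h1 h2 h3 h4].
by split; (apply: le_trans; [eassumption|rewrite (ler_qz HF) lerN2]).
Qed.

Lemma box0 i j k l : box i j k l 0.
Proof. by split; rewrite /= (absF0 HF) ltW// (qz_gt0 HF). Qed.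

Lemma content_boxD (i j k l i' j' k' l' : bool) :
  (i <= i')%N -> (j <= j')%N -> (k <= k')%N -> (l <= l')%N ->
  nu (box i j k l `\` box i' j' k' l') =
  (q%:R^-1 ^+ (i + j + k + l) - q%:R^-1 ^+ (i' + j' + k' + l'))
    * nu (box 0 0 0 0).
Proof.
move=> hi hj hk hl; rewrite (contentD HF Hnu); first last.
- by apply: box_subset; rewrite lez_nat.
- exact: (compact_open_box HF).
- exact: (compact_open_box HF).
by rewrite !content_box_unit mulrBl.
Qed.

Lemma absF_unit_of (x : F) : absF x <= 1 -> ~~ (absF x <= qz (- 1)) -> absF x = 1.
Proof.
move=> x1; rewrite -ltNge => h; apply/eqP; rewrite eq_le x1 leNgt.
by rewrite -[1 in ltRHS](expr0z q%:R) (absF_lt_qz HF) sub0r -ltNge.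
Qed.

(** Here the first coordinate is a unit and is the slope of [Q] in the second one; integrality of
    [Q] gives [m1 = 0]. *)
Lemma total_weight_slope_a :
  tw (box 0 0 0 0 `\` box 1 0 0 0) =
  - q%:R^-1 * (1 - q%:R^-1) * (1 - q%:R^-1) * nu (box 0 0 0 0).
Proof.
rewrite (@total_weight_unit_slope _ _ _ _ HF _ Hnu _ A_le1 _ (fun v => v.1.1.1)
  (0, 1, 0, 0) 0).
- rewrite (@content_boxD false false false false true false false false)//=.
  by rewrite expr1 expr0 addr0 expr0z; ring.
- apply: (compact_openD HF); exact: (compact_open_box HF).
- by move=> v x; rewrite /Q /=; ring.
- move=> v [[h1 h2 h3 h4] hn]; apply: absF_unit_of.
    by move: h1; rewrite oppr0 expr0z.
  by apply/negP => h; apply: hn; split.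
- move=> v x [[h1 h2 h3 h4] hn]; rewrite oppr0 => hx.
  split; rewrite /smul/=.
    split; rewrite /= ?mulr0 ?addr0 ?mulr1//.
    by apply: (absF_add_le HF) => //; rewrite oppr0.
  by move=> [k1 k2 k3 k4]; apply: hn; move: k1 k3 k4; rewrite /= !mulr0 !addr0.
- move=> v [[]]; rewrite !oppr0 !expr0z => h1 h2 h3 h4 _.
  have sq1 (x : F) : absF x <= 1 -> absF (x ^+ 2) <= 1.
    by move=> hx; rewrite (absFX HF) exprn_ile1// (absF_ge0 HF).
  apply: (absF_add_le HF); first by rewrite (absFM HF) mulr_ile1 ?(absF_ge0 HF).
  apply: (absF_sub_le HF); first exact: sq1.
  by rewrite (absFM HF) mulr_ile1 ?(absF_ge0 HF)//; exact: sq1.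
Qed.

(** The second coordinate is now the unit slope, and [m1 = 1] because both parts of [Q] lie in the
    maximal ideal. The index [l] separates the two cases: [true] when [A] is a unit, so that [t]
    must be small too, and [false] when [A] itself makes [A * t ^+ 2] small. *)
Lemma total_weight_slope_b (l : bool) :
  (forall z t, absF z <= q%:R^-1 -> absF t <= qz (- l%:Z) ->
    absF (z ^+ 2 - A * t ^+ 2) <= q%:R^-1) ->
  tw (box 1 0 1 l `\` box 1 1 1 l) =
  - q%:R * (1 - q%:R^-1) * (q%:R^-1 ^+ (2 + l) - q%:R^-1 ^+ (3 + l))
    * nu (box 0 0 0 0).
Proof.
move=> hN.
rewrite (@total_weight_unit_slope _ _ _ _ HF _ Hnu _ A_le1 _ (fun v => v.1.1.2)
  (1, 0, 0, 0) 1).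
- rewrite (@content_boxD true false true l true true true l)//=.
  rewrite (_ : qz (1 + 1) = q%:R * q%:R)//.
  have := qR_neq0 HF; move: (q%:R) => y y0; rewrite !exprS.
  by move: (y^-1 ^+ l) => X; field.
- apply: (compact_openD HF); exact: (compact_open_box HF).
- by move=> v x; rewrite /Q /=; ring.
- move=> v [[h1 h2 h3 h4] hn]; apply: absF_unit_of.
    by move: h2; rewrite oppr0 expr0z.
  by apply/negP => h; apply: hn; split.
- move=> v x [[h1 h2 h3 h4] hn] hx.
  split; rewrite /smul/=.
    split; rewrite /= ?mulr0 ?addr0 ?mulr1//.
    exact: (absF_add_le HF).
  by move=> [k1 k2 k3 k4]; apply: hn; move: k2 k3 k4; rewrite /= !mulr0 !addr0.
- move=> v [[]]; rewrite !oppr0 expr0z exprN1 => h1 h2 h3 h4 _.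
  apply: (absF_add_le HF); last exact: hN.
  rewrite (absFM HF) -[leRHS]mulr1 ler_pM ?(absF_ge0 HF)//.
Qed.

(** With u = q^-1 and up to the factor 1 - u times the volume of the unit box, the regions
    contribute - (u - u^2) for a unit first coordinate, u - u^3 for a unit among the last two, and -
    (u^2 - u^3) for a unit second coordinate. *)
Lemma weight_cancel_unramified : absF A = 1 ->
  (forall z t, absF z = 1 \/ absF t = 1 -> absF z <= 1 ->
    absF t <= 1 -> absF (z ^+ 2 - A * t ^+ 2) = 1) ->
  tw (box 0 0 0 0 `\` box 1 1 1 1) = 0.
Proof.
move=> A1 unitN.
have cB := compact_open_box HF.
rewrite (total_weight_chain (cB 0 0 0 0) (cB 1 0 0 0)) //; try exact: box0; try exact: box_subset.
rewrite (total_weight_chain (cB 1 0 0 0) (cB 1 0 1 1)) //; try exact: box0; try exact: box_subset.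
rewrite total_weight_slope_a (@total_weight_slope_b true); last first.
  rewrite exprN1 => z t hz ht.
  have sq1 (x : F) : absF x <= q%:R^-1 -> absF (x ^+ 2) <= q%:R^-1.
    move=> hx; rewrite (absFX HF) expr2; apply: le_trans (_ : q%:R^-1 * 1 <= _).
      rewrite ler_pM ?(absF_ge0 HF)//; apply: le_trans hx _.
      by rewrite invf_le1 ?(qR_gt0 HF)// ltW// (qR_gt1 HF).
    by rewrite mulr1.
  apply: (absF_sub_le HF); first exact: sq1.
  by rewrite (absF_mul_unit HF)//; exact: sq1.
rewrite (@total_weight_const _ _ _ _ HF _ Hnu _ A_le1 _ 0).
- rewrite (@content_boxD true false false false true false true true)//=.
  rewrite addr0 expr0z.
  have := qR_neq0 HF; move: (q%:R) => y y0; rewrite /= !exprS expr0.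
  by field.
- move=> v [[]]; rewrite !oppr0 !expr0z exprN1 => h1 h2 h3 h4 hn.
  have zt : absF v.1.2 = 1 \/ absF v.2 = 1.
    have [hz|hz] := boolP (absF v.1.2 <= qz (- 1)); last by left; exact: absF_unit_of.
    right; apply: absF_unit_of => //; apply/negP => ht; apply: hn.
    by split => //; rewrite ?exprN1 ?oppr0 ?expr0z.
  have N1 := unitN _ _ zt h3 h4.
  rewrite /Q (absF_addl_lt HF)// N1 (absFM HF).
  apply: le_lt_trans (_ : q%:R^-1 * 1 < _); first by rewrite ler_pM ?(absF_ge0 HF).
  by rewrite mulr1 invf_lt1 ?(qR_gt0 HF)// (qR_gt1 HF).
Qed.

(** The unit coordinates are now peeled off one at a time, in the order first, third, second,
    fourth. In the same units each region contributes u - u^2 with alternating signs, starting with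
    a minus. *)
Lemma weight_cancel_ramified : absF A = q%:R^-1 ->
  tw (box 0 0 0 0 `\` box 1 1 1 1) = 0.
Proof.
move=> Aq.
have cB := compact_open_box HF.
have q1 : q%:R^-1 < 1 :> R by rewrite invf_lt1 ?(qR_gt0 HF)// (qR_gt1 HF).
have qi0 : 0 < q%:R^-1 :> R by rewrite invr_gt0 (qR_gt0 HF).
rewrite (total_weight_chain (cB 0 0 0 0) (cB 1 0 0 0)) //; try exact: box0; try exact: box_subset.
rewrite (total_weight_chain (cB 1 0 0 0) (cB 1 0 1 0)) //; try exact: box0; try exact: box_subset.
rewrite (total_weight_chain (cB 1 0 1 0) (cB 1 1 1 0)) //; try exact: box0; try exact: box_subset.
have sq1 (x : F) : absF x <= 1 -> absF (x ^+ 2) <= 1.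
  by move=> hx; rewrite (absFX HF) exprn_ile1// (absF_ge0 HF).
have sqq (x : F) : absF x <= q%:R^-1 -> absF (x ^+ 2) <= q%:R^-1 * q%:R^-1.
  by move=> hx; rewrite (absFX HF) expr2 ler_pM ?(absF_ge0 HF).
have At (t : F) : absF t <= 1 -> absF (A * t ^+ 2) <= q%:R^-1.
  by move=> ht; rewrite (absFM HF) Aq ler_piMr ?(ltW qi0)// sq1.
have qq : q%:R^-1 * q%:R^-1 < q%:R^-1 :> R by rewrite gtr_pMr.
rewrite total_weight_slope_a (@total_weight_slope_b false); last first.
  rewrite oppr0 expr0z => z t hz ht.
  apply: (absF_sub_le HF); last exact: At.
  by apply: le_trans (sqq _ hz) _; exact: ltW.
rewrite (@total_weight_const _ _ _ _ HF _ Hnu _ A_le1 (box 1 0 0 0 `\` _) 0); last first.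
  move=> v [[]]; rewrite !oppr0 !expr0z exprN1 => h1 h2 h3 h4 hn.
  have z1 : absF v.1.2 = 1.
    apply: absF_unit_of => //; apply/negP => hz; apply: hn.
    by split => //; rewrite ?exprN1 ?oppr0 ?expr0z.
  have N1 : absF (v.1.2 ^+ 2 - A * v.2 ^+ 2) = 1.
    rewrite (absF_addr_lt HF) (absFX HF) z1 expr1n// (absFN HF).
    exact: le_lt_trans (At _ h4) q1.
  rewrite /Q (absF_addl_lt HF)// N1 (absFM HF).
  apply: le_lt_trans (_ : q%:R^-1 * 1 < _); first by rewrite ler_pM ?(absF_ge0 HF).
  by rewrite mulr1.
rewrite (@total_weight_const _ _ _ _ HF _ Hnu _ A_le1 (box 1 1 1 0 `\` _) 1); last first.
  move=> v [[]]; rewrite !oppr0 !expr0z !exprN1 => h1 h2 h3 h4 hn.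
  have t1 : absF v.2 = 1.
    apply: absF_unit_of => //; apply/negP => hz; apply: hn.
    by split => //; rewrite ?exprN1 ?oppr0 ?expr0z.
  have At1 : absF (A * v.2 ^+ 2) = q%:R^-1.
    by rewrite (absFM HF) (absFX HF) t1 expr1n mulr1.
  have N1 : absF (v.1.2 ^+ 2 - A * v.2 ^+ 2) = q%:R^-1.
    rewrite (absF_addl_lt HF) (absFN HF) At1//.
    exact: le_lt_trans (sqq _ h3) qq.
  rewrite /Q (absF_addl_lt HF)// N1 (absFM HF).
  by apply: le_lt_trans qq; rewrite ler_pM ?(absF_ge0 HF).
rewrite (@content_boxD true false false false true false true false)//=.
rewrite (@content_boxD true true true false true true true true)//=.
rewrite addr0 expr0z (_ : qz (1 + 1) = q%:R * q%:R)//.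
have := qR_neq0 HF; move: (q%:R) => y y0; rewrite /= !exprS expr0.
by field.
Qed.

End FundamentalDomain.

(** * Anisotropy of the binary norm forms *)

Section Anisotropic.
Context {R : realType} {F : fieldType} {absF : F -> R} {q p : nat}.
Hypothesis HF : local_field absF q.
Local Notation qz k := (q%:R ^ (k : int) : R).

(** Cancellation is possible only when [z] and [t] have equal absolute value, and then it would make
    [z / t] an approximate square root of [A], against Hensel's lemma. *)
Lemma norm_form_unramified (A z t : F) : residual_char absF p -> odd p ->
  absF A = 1 -> ~ is_square A ->
  absF (z ^+ 2 - A * t ^+ 2) = Num.max (absF z) (absF t) ^+ 2.
Proof.
move=> pc po A1 nA.
have At : absF (A * t ^+ 2) = absF t ^+ 2.
  by rewrite (absF_mul_unit HF)// (absFX HF).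
have lt2 (x y : F) : absF x < absF y -> absF x ^+ 2 < absF y ^+ 2.
  by move=> h; rewrite ltr_pXn2r ?nnegrE ?(absF_ge0 HF).
have [zt|tz|e] := ltgtP (absF z) (absF t).
- by rewrite (absF_addl_lt HF) (absFN HF) At// (absFX HF); exact: lt2.
- by rewrite (absF_addr_lt HF) (absFX HF)// (absFN HF) At; exact: lt2.
have [t0|t0] := eqVneq t 0.
  have z0 : z = 0 by apply/eqP; rewrite -(absF_eq0 HF) e t0 (absF0 HF).
  by rewrite t0 z0 expr0n mulr0 subrr (absF0 HF) expr0n.
apply/eqP; rewrite eq_le; apply/andP; split.
  by apply: (absF_sub_le HF); rewrite ?At ?(absFX HF) ?e.
rewrite leNgt; apply/negP => h; apply: nA.
have at0 : absF t != 0 by rewrite (absF_eq0 HF).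
apply: (hensel_sqrt HF pc po (x0 := z / t)); first by rewrite (absF_div HF) e divff.
have -> : (z / t) ^+ 2 - A = (z ^+ 2 - A * t ^+ 2) / t ^+ 2 by field.
by rewrite (absF_div HF) (absFX HF) ltr_pdivrMr ?mul1r -?e ?exprn_gt0// e (absF_gt0 HF).
Qed.

(** The two terms have valuations of opposite parity, so they tie only when both vanish. *)
Lemma norm_form_ramified (A z t : F) : absF A = q%:R^-1 ->
  absF (z ^+ 2 - A * t ^+ 2) = Num.max (absF z ^+ 2) (q%:R^-1 * absF t ^+ 2).
Proof.
move=> Aq.
have At : absF (A * t ^+ 2) = q%:R^-1 * absF t ^+ 2.
  by rewrite (absFM HF) Aq (absFX HF).
have [zt|tz|e] := ltgtP (absF z ^+ 2) (q%:R^-1 * absF t ^+ 2).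
- by rewrite (absF_addl_lt HF) (absFN HF) At// (absFX HF).
- by rewrite (absF_addr_lt HF) (absFX HF)// (absFN HF) At.
have [t0|t0] := eqVneq t 0.
  move: e; rewrite t0 (absF0 HF) [0 ^+ 2]expr0n/= !mulr0 => /eqP.
  rewrite sqrf_eq0 (absF_eq0 HF) => /eqP ->.
  by rewrite ![0 ^+ 2]expr0n/= ?mulr0 ?subr0 ?(absF0 HF) ?expr0n ?mulr0 ?maxxx.
have z0 : z != 0.
  apply/eqP => z0; move: e; rewrite z0 (absF0 HF) expr0n/= => /esym/eqP.
  by rewrite mulf_eq0 invr_eq0 (negPf (qR_neq0 HF)) sqrf_eq0 (absF_eq0 HF) (negPf t0).
have [j hj] := absF_discrete HF t0; have [k hk] := absF_discrete HF z0.
have : k + k = - 1 + (j + j).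
  by apply: (qz_inj HF); move: e; rewrite hj hk !expr2 !(qzD HF) exprN1.
lia.
Qed.

Lemma norm_form_anisotropic (A : F) : residual_char absF p -> odd p ->
  absF A = 1 \/ absF A = q%:R^-1 -> ~ is_square A ->
  forall z t (k : int), qz k <= absF z \/ qz k <= absF t ->
  qz (k + k - 1) <= absF (z ^+ 2 - A * t ^+ 2).
Proof.
move=> pc po hA nA z t k hk.
have k0 := qz_gt0 HF k.
have sq x : qz k <= absF x -> qz (k + k) <= absF x ^+ 2.
  by move=> h; rewrite (qzD HF) -expr2 ler_pXn2r ?nnegrE ?(absF_ge0 HF) ?(ltW k0).
have le1 : qz (k + k - 1) <= qz (k + k) by rewrite (ler_qz HF); lia.
case: hA => hA.
  rewrite norm_form_unramified//; apply: le_trans le1 _.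
  rewrite (qzD HF) -expr2; apply: lerXn2r; rewrite ?nnegrE ?(ltW k0)//.
    by rewrite le_max (absF_ge0 HF).
  by rewrite le_max; case: hk => ->; rewrite ?orbT.
rewrite norm_form_ramified// le_max; case: hk => hk.
  by rewrite (le_trans le1 (sq _ hk)).
apply/orP; right; rewrite (qzD HF) exprN1 mulrC ler_pM2l ?sq//.
by rewrite invr_gt0 (qR_gt0 HF).
Qed.

End Anisotropic.

(** * Linear changes of coordinates *)

Section LinearChange.
Context {R : realType} {F : fieldType} {absF : F -> R} {q : nat}.
Hypothesis HF : local_field absF q.
Local Notation V := (F * F * F * F)%type.
Local Notation qz k := (q%:R ^ (k : int) : R).
Local Notation co := (@compact_open R F absF q).
Local Notation nrm := (@nrm R F absF).

Definition lin (e1 e2 e3 e4 : V) (v : V) : V :=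
  smul v.1.1.1 e1 + smul v.1.1.2 e2 + smul v.1.2 e3 + smul v.2 e4.

Lemma pair4P (v w : V) : v.1.1.1 = w.1.1.1 -> v.1.1.2 = w.1.1.2 ->
  v.1.2 = w.1.2 -> v.2 = w.2 -> v = w.
Proof.
by case: v w => [[[a b] c] d] [[[a' b'] c'] d'] /= -> -> -> ->.
Qed.

Lemma linD e1 e2 e3 e4 v w :
  lin e1 e2 e3 e4 (v + w) = lin e1 e2 e3 e4 v + lin e1 e2 e3 e4 w.
Proof. by apply: pair4P; rewrite /lin /smul /=; ring. Qed.

Lemma lin_smul e1 e2 e3 e4 c v :
  lin e1 e2 e3 e4 (smul c v) = smul c (lin e1 e2 e3 e4 v).
Proof. by apply: pair4P; rewrite /lin /smul /=; ring. Qed.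

Lemma lin_bounded e1 e2 e3 e4 : exists B : nat, forall v (k : int),
  nrm v <= qz k -> nrm (lin e1 e2 e3 e4 v) <= qz (B%:Z + k).
Proof.
have [B1 h1] := qz_large HF (nrm e1); have [B2 h2] := qz_large HF (nrm e2).
have [B3 h3] := qz_large HF (nrm e3); have [B4 h4] := qz_large HF (nrm e4).
exists (B1 + B2 + B3 + B4)%N => v k /nrm_leP[v1 v2 v3 v4].
have H (B : nat) (x : F) (e : V) : (B <= B1 + B2 + B3 + B4)%N ->
    nrm e <= qz B -> absF x <= qz k ->
    nrm (smul x e) <= qz ((B1 + B2 + B3 + B4)%N%:Z + k).
  move=> hB he hx; rewrite (nrm_smul HF) addrC (qzD HF).
  rewrite ler_pM ?(absF_ge0 HF) ?(nrm_ge0 HF)//.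
  by apply: le_trans he _; rewrite (ler_qz HF) lez_nat.
repeat apply: (nrm_add_le HF).
- by apply: H h1 v1; lia.
- by apply: H h2 v2; lia.
- by apply: H h3 v3; lia.
- by apply: H h4 v4; lia.
Qed.

Context {phi psi : V -> V}.
Hypothesis psiD : forall v w, psi (v + w) = psi v + psi w.
Hypothesis psi_bounded : exists B : nat, forall v (k : int),
  nrm v <= qz k -> nrm (psi v) <= qz (B%:Z + k).
Hypothesis phi_bounded : exists B : nat, forall v (k : int),
  nrm v <= qz k -> nrm (phi v) <= qz (B%:Z + k).
Hypothesis phiK : cancel phi psi.
Hypothesis psiK : cancel psi phi.

Lemma compact_open_pull S : co S -> co [set v | S (psi v)].
Proof.
move=> [n [bS pS]]; have [B hB] := psi_bounded; have [B' hB'] := phi_bounded.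
apply: (@compact_openP _ _ _ _ HF (B'%:Z + n%:Z) (B%:Z + n%:Z)).
  by move=> v /= /bS /hB'; rewrite psiK.
move=> v e /= Sv he; rewrite psiD; apply: pS => //.
by have := hB _ _ he; rewrite opprD addrA subrr sub0r.
Qed.

Lemma content_pull nu : @content R F absF q nu ->
  @content R F absF q (fun S => nu [set v | S (psi v)]).
Proof.
move=> Hnu; split.
- move=> S T cS cT ST; rewrite -(contentU Hnu) //.
  + exact: compact_open_pull.
  + exact: compact_open_pull.
  + apply: eq_setP => v; split => // -[h1 h2].
    have : (S `&` T) (psi v) by [].
    by rewrite ST.
- move=> S u cS /=; rewrite -(content_shift Hnu (phi u) (compact_open_pull cS)).
  congr (nu _); apply: eq_setP => v /=.
  suff -> : psi (v - phi u) = psi v - u by [].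
  have -> : psi v = psi (v - phi u) + u by rewrite -{2}(phiK u) -psiD subrK.
  by rewrite addrK.
Qed.

End LinearChange.

(** * Reduction of the quadric to its normal form *)

Section QuadricLevels.
Context {R : realType} {F : fieldType} {absF : F -> R} {q p : nat}.
Hypothesis HF : local_field absF q.
Hypotheses (p_char : residual_char absF p) (p_odd : odd p).
Local Notation V := (F * F * F * F)%type.
Local Notation qz k := (q%:R ^ (k : int) : R).
Local Notation co := (@compact_open R F absF q).
Local Notation nrm := (@nrm R F absF).

(** Multiplication by [x0 + y0 * sqrt r] turns [X ^+ 2 - r * Y ^+ 2] into [al] times itself. The
    second binary form also represents [al], so a basis through [(z0, t0)] makes it
    [al * (Z ^+ 2 - r * A * T ^+ 2)]. In the difference, [X ^+ 2 - Z ^+ 2] is a hyperbolic plane and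
    the rest is [- r * al] times the norm form of [A]. *)
Lemma quadric_normal_form (A D r : F) : A != 0 -> D != 0 -> r != 0 ->
  ~ is_square A -> exists (c A0 : F) (phi psi : V -> V),
  [/\ c != 0, (absF A0 = 1 \/ absF A0 = q%:R^-1) /\ ~ is_square A0,
      [/\ cancel phi psi, cancel psi phi, {morph phi : v w / v + w},
          {morph psi : v w / v + w} & forall a v, phi (smul a v) = smul a (phi v)],
      (exists B : nat, forall v (k : int),
        nrm v <= qz k -> nrm (phi v) <= qz (B%:Z + k)) /\
      (exists B : nat, forall v (k : int),
        nrm v <= qz k -> nrm (psi v) <= qz (B%:Z + k))
    & forall v, quadric r A D (phi v) = c * @normal_form F A0 v].
Proof.
move=> hA hD hr nA; have n2 := two_neq0 HF p_char p_odd.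
have [x0 [y0 [z0 [t0 [e al0]]]]] := common_norm_value HF p_char p_odd hA hD hr nA.
have [k k0 hk] := normalize_by_square HF p_odd hA.
(* In [phi] the multipliers of [(x0, y0)] and [(z0, t0)] are [X = (b - r * a) / 2] and
   [Z = (b + r * a) / 2], so that [X ^+ 2 - Z ^+ 2 = - r * a * b]. The factor [k] replaces [A] by
   [A * k ^+ 2]. *)
set al := x0 ^+ 2 - r * y0 ^+ 2 in e al0.
have al1 : al = x0 ^+ 2 - r * y0 ^+ 2 by [].
pose phi := lin (- r * x0 / 2, - r * y0 / 2, r * z0 / 2, r * t0 / 2)
  (x0 / 2, y0 / 2, z0 / 2, t0 / 2) (r * y0, x0, 0, 0) (0, 0, - r * t0 * k, - A * z0 * k).
pose psi := lin (- x0 / (r * al), x0 / al, - y0 / al, 0)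
  (y0 / al, - r * y0 / al, x0 / al, 0)
  (A * D * z0 / (r * al), A * D * z0 / al, 0, D * t0 / (k * al))
  (- D * t0 / al, - r * D * t0 / al, 0, - D * z0 / (k * al)).
exists (- r * al), (A * k ^+ 2), phi, psi.
move: al e al1 al0 @phi @psi => al e al1 al0 phi psi.
split.
- by rewrite mulf_neq0// oppr_eq0.
- split; first exact: hk.
  move=> [x hx]; apply: nA; exists (x / k).
  by rewrite expr_div_n -hx mulfK// expf_neq0.
- split.
  + case=> [[[a b] z] t].
    (* The identities hold only modulo the two expressions of [al], now a variable. Each coordinate
       is therefore first written through the quotients [r1] and [r2], which equal 1. *)
    have r1 : (A * D * z0 ^+ 2 - r * D * t0 ^+ 2) / al = 1 by rewrite -e divff.
    have r2 : (x0 ^+ 2 - r * y0 ^+ 2) / al = 1 by rewrite -al1 divff.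
    apply: pair4P; rewrite /phi /psi /lin /smul /=.
    * transitivity (((A * D * z0 ^+ 2 - r * D * t0 ^+ 2) / al * ((b + r * a) / 2)
        - (x0 ^+ 2 - r * y0 ^+ 2) / al * ((b - r * a) / 2)) / r).
        by field; rewrite n2 al0 hr.
      by rewrite r1 r2; field; rewrite n2 hr.
    * transitivity ((A * D * z0 ^+ 2 - r * D * t0 ^+ 2) / al * ((b + r * a) / 2)
        + (x0 ^+ 2 - r * y0 ^+ 2) / al * ((b - r * a) / 2)).
        by field; rewrite n2 al0 ?hr.
      by rewrite r1 r2; field; rewrite n2.
    * transitivity ((x0 ^+ 2 - r * y0 ^+ 2) / al * z).
        by field; rewrite ?n2 ?al0 ?hr.
      by rewrite r2 mul1r.
    * transitivity ((A * D * z0 ^+ 2 - r * D * t0 ^+ 2) / al * t).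
        by field; rewrite ?n2 ?al0 ?hr ?k0.
      by rewrite r1 mul1r.
  + case=> [[[x y] z] t].
    have r1 : (A * D * z0 ^+ 2 - r * D * t0 ^+ 2) / al = 1 by rewrite -e divff.
    have r2 : (x0 ^+ 2 - r * y0 ^+ 2) / al = 1 by rewrite -al1 divff.
    apply: pair4P; rewrite /phi /psi /lin /smul /=.
    * transitivity ((x0 ^+ 2 - r * y0 ^+ 2) / al * x).
        by field; rewrite ?n2 ?al0 ?hr ?k0.
      by rewrite r2 mul1r.
    * transitivity ((x0 ^+ 2 - r * y0 ^+ 2) / al * y).
        by field; rewrite ?n2 ?al0 ?hr ?k0.
      by rewrite r2 mul1r.
    * transitivity ((A * D * z0 ^+ 2 - r * D * t0 ^+ 2) / al * z).
        by field; rewrite ?n2 ?al0 ?hr ?k0.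
      by rewrite r1 mul1r.
    * transitivity ((A * D * z0 ^+ 2 - r * D * t0 ^+ 2) / al * t).
        by field; rewrite ?n2 ?al0 ?hr ?k0.
      by rewrite r1 mul1r.
  + by move=> v w; exact: linD.
  + by move=> v w; exact: linD.
  + by move=> a v; exact: lin_smul.
- by split; exact: (lin_bounded HF).
case=> [[[a b] z] t].
rewrite /phi /lin /smul /normal_form /quadric /=.
transitivity ((x0 ^+ 2 - r * y0 ^+ 2) * (((b - r * a) / 2) ^+ 2 - r * z ^+ 2) -
  (A * D * z0 ^+ 2 - r * D * t0 ^+ 2) * (((b + r * a) / 2) ^+ 2
    - r * (A * k ^+ 2) * t ^+ 2)).
  by field.
by rewrite -e -al1; field.
Qed.

(** Returns to the original coordinates and the original volume, in the form that the integration
    consumes. The multiplier [c] of the normal form rescales the thresholds, and the vanishing sum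
    is the total weight of the unit sphere. *)
Lemma quadric_levels (nu : set V -> R) (A D r : F) :
  @content R F absF q nu -> A != 0 -> D != 0 -> r != 0 -> ~ is_square A ->
  exists c : F, c != 0 /\ let S k :=
    [set v | nrm v = 1 /\ absF (quadric r A D v) <= absF c * qz (- k)] in
  let N k := nu (S k) - nu (S (k + 1)) in
  (forall k, co (S k)) /\ exists K : nat,
    [/\ forall k : int, k <= 1 - K%:Z -> S k = [set v | nrm v = 1],
        forall k : int, K%:Z <= k -> N k = q%:R * N (k + 1) &
        \sum_(k <- window K) (N k - q%:R * N (k + 1)) * qz (k + k) = 0].
Proof.
move=> Hnu hA hD hr nA.
have [c [A0 [phi [psi [c0 [hA0 nA0] [phiK psiK phiD psiD phiZ] [bphi bpsi] hQ]]]]] :=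
  quadric_normal_form hA hD hr nA.
have A0_le1 : absF A0 <= 1.
  by case: hA0 => ->; rewrite ?lexx// invf_le1 ?(qR_gt0 HF)// ltW// (qR_gt1 HF).
have aniso := norm_form_anisotropic HF p_char p_odd hA0 nA0.
have Hnu' := content_pull HF psiD bpsi bphi phiK psiK Hnu.
set nu' := (fun S => nu _) in Hnu'.
have [w hw] := exprz_uniformizer HF.
have w1 : absF (w 1) = q%:R by rewrite hw expr1z.
(* The standard lattice seen in the new coordinates; the unit sphere becomes its fundamental domain
   [U]. *)
pose L : set V := [set v | nrm (phi v) <= qz 0].
have phi0 : phi 0 = 0 by apply: (addrI (phi 0)); rewrite -phiD !addr0.
have cL : co L.
  exact: (compact_open_pull HF phiD bphi bpsi phiK (compact_open_ball0 HF 0)).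
pose U : set V := [set v | nrm (phi v) = 1].
have UE : U = L `\` [set v | L (smul (w 1) v)].
  apply: eq_setP => v; rewrite /U /L /= phiZ (nrm_smul HF) w1 expr0z.
  have -> : (q%:R * nrm (phi v) <= 1) = (nrm (phi v) < 1).
    have := nrm_lt_qz HF (phi v) 0; rewrite expr0z sub0r exprN1 => ->.
    by rewrite -ler_pdivlMl ?(qR_gt0 HF)// mulr1.
  split; first by move=> ->; rewrite lexx ltxx.
  by move=> [h1 /negP]; rewrite -leNgt => h2; apply/eqP; rewrite eq_le h1.
have scL (v : V) : L (smul (w 1) v) -> L v.
  rewrite /L /= phiZ (nrm_smul HF) w1; apply: le_trans.
  by rewrite ler_peMl ?(nrm_ge0 HF)// ltW// (qR_gt1 HF).
have cU : co U.
  by rewrite UE; apply: (compact_openD HF) => //; apply: (compact_open_smul HF) => //;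
    rewrite -(absF_eq0 HF) w1 (qR_neq0 HF).
have U0 : ~ U 0 by rewrite /U /= phi0 (nrm0 HF) => /esym/eqP; rewrite oner_eq0.
have wU : @total_weight R F absF q nu' A0 U = 0.
  have [n [_ pL]] := cL.
  have L0 : L 0 by rewrite /L /= phi0 (nrm0 HF) expr0z.
  pose L1 : set V := [set v | nrm v <= qz (- n%:Z)].
  have L10 : L1 0 by rewrite /L1 /= (nrm0 HF) ltW// (qz_gt0 HF).
  have cL1 : co L1 by exact: (compact_open_ball0 HF).
  have scL1 : [set v | L1 (smul (w 1) v)] `<=` L1.
    move=> v; rewrite /L1 /= (nrm_smul HF) w1; apply: le_trans.
    by rewrite ler_peMl ?(nrm_ge0 HF)// ltW// (qR_gt1 HF).
  (* The lattice [L] and the unit box [B0] both contain the small ball [L1], so each fundamental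
     domain is compared with that of [L1]. *)
  have tfd := total_weight_fundamental_domain HF Hnu' A0_le1 aniso w1.
  rewrite UE (tfd L L1) //; last by move=> v hv; rewrite -[v]add0r; exact: pL.
  pose B0 := @box R F absF q 0 0 0 0.
  have B0E v : B0 v <-> nrm v <= 1.
    by rewrite /B0 /box /= oppr0 expr0z; split => [h|/nrm_leP//]; apply/nrm_leP.
  rewrite -(tfd B0 L1) //.
  - have -> : [set v | B0 (smul (w 1) v)] = @box R F absF q 1 1 1 1.
      apply: eq_setP => v; rewrite /= B0E (nrm_smul HF) w1 /box /= exprN1.
      rewrite -ler_pdivlMl ?(qR_gt0 HF)// mulr1.
      by split => [/nrm_leP[]|h]; [split|apply/nrm_leP].
    case: (hA0) => hA1; last exact: weight_cancel_ramified.
    apply: weight_cancel_unramified => // z t zt z1 t1.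
    rewrite (norm_form_unramified HF _ _ p_char)//.
    suff -> : Num.max (absF z) (absF t) = 1 by rewrite expr1n.
    by apply/eqP; rewrite eq_le ge_max z1 t1 le_max; case: zt => ->; rewrite lexx ?orbT.
  - exact: (compact_open_box HF).
  - move=> v hv; apply/B0E; apply: le_trans hv _.
    by rewrite -[leRHS](expr0z q%:R) (ler_qz HF); lia.
  - move=> v; rewrite /= !B0E (nrm_smul HF) w1; apply: le_trans.
    by rewrite ler_peMl ?(nrm_ge0 HF)// ltW// (qR_gt1 HF).
have SE k : [set v | nrm v = 1 /\ absF (quadric r A D v) <= absF c * qz (- k)] =
    [set v | (@level R F absF q A0 U k) (psi v)].
  apply: eq_setP => v; rewrite /level /U /= psiK -[in quadric r A D v](psiK v) hQ.
  by rewrite (absFM HF) ler_pM2l ?(absF_gt0 HF).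
exists c; split => //=; split.
  move=> k; rewrite SE; apply: (compact_open_pull HF psiD bpsi bphi psiK).
  exact: (compact_open_level HF A0_le1).
have [K hK] := tame_punctured HF Hnu' A0_le1 aniso cU U0.
have [M hM] := level_low HF A0_le1 cU.
(* The successor lets the level at [1 - (K + M).+1] still be the whole sphere, so that two
   consecutive low levels coincide. *)
exists (K + M).+1; split.
- move=> k hk; rewrite SE hM; last by lia.
  by apply: eq_setP => v; rewrite /U /= psiK.
- move=> k hk; rewrite !SE.
  have := hK k (or_intror _); rewrite /weight => /(_ _)/eqP; rewrite mulf_eq0.
  rewrite (negPf (qz_neq0 HF _)) orbF subr_eq0 => h; apply/eqP; apply: h; lia.
- rewrite -[RHS]wU (total_weight_window A0_le1 (K := (K + M).+1)).
    by apply: eq_bigr => k _; rewrite !SE.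
  by move=> k hk; apply: hK; lia.
Qed.

End QuadricLevels.

(** * The product Haar measure as a volume on compact open sets *)

Section HaarContent.
Context {R : realType} {F : fieldType} {absF : F -> R} {q : nat}.
Hypothesis HF : local_field absF q.
Local Notation X := (borelF absF).
Local Notation V := (F * F * F * F)%type.
Local Notation qz k := (q%:R ^ (k : int) : R).
Local Notation co := (@compact_open R F absF q).
Local Notation nrm := (@nrm R F absF).
Context {mu : {sigma_finite_measure set X -> \bar R}}.
Hypothesis mu_haar : is_normalized_haar mu.
Local Notation mu4 := (mu \x mu \x mu \x mu)%E.

Definition ball1 (a : F) (n : nat) : set X := [set x : F | absF (x - a) <= qz (- n%:Z)].

Lemma measurable_ball1 a n : measurable (ball1 a n).
Proof.
apply: sub_sigma_algebra => x xa; exists (qz (- n%:Z)); first exact: (qz_gt0 HF).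
move=> y yx; rewrite /ball1 /= -(subrK x y) -addrA; apply: (absF_add_le HF) => //.
exact: ltW.
Qed.

Lemma haar_ball1 a n : mu (ball1 a n) = mu (ball1 0 n).
Proof.
rewrite -(mu_haar.1 a _ (measurable_ball1 0 n)); congr (mu _).
apply: eq_setP => x; split => [xa|[y hy <-]].
  exists (x - a); first by rewrite /ball1 /= subr0.
  by rewrite addrC subrK.
by move: hy; rewrite /ball1 /= subr0 addrC addKr.
Qed.

Lemma haar_ball1_fin n : mu (ball1 0 n) \is a fin_num.
Proof.
rewrite ge0_fin_numE ?measure_ge0//; apply: le_lt_trans (ltry 1).
rewrite -mu_haar.2; apply: le_measure; rewrite ?inE; first exact: measurable_ball1.
  rewrite (_ : integer_ring absF = ball1 0 0); first exact: measurable_ball1.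
  by apply: eq_setP => x; rewrite /ball1 /integer_ring /= subr0 oppr0 expr0z.
move=> x; rewrite /ball1 /integer_ring /= subr0 => h; apply: le_trans h _.
by rewrite -[leRHS](expr0z q%:R) (ler_qz HF); lia.
Qed.

Definition ball4 (c : V) (n : nat) : set (X * X * X * X) :=
  ball1 c.1.1.1 n `*` ball1 c.1.1.2 n `*` ball1 c.1.2 n `*` ball1 c.2 n.

Lemma ball4E c n : ball4 c n = [set v : V | nrm (v - c) <= qz (- n%:Z)].
Proof.
apply: eq_setP => v; split; last by move=> /nrm_leP[].
by move=> [[[h1 h2] h3] h4]; apply/nrm_leP.
Qed.

Lemma measurable_ball4 c n : measurable (ball4 c n).
Proof. by rewrite /ball4; repeat apply: measurableX; exact: measurable_ball1. Qed.

Lemma haar_ball4 c n : mu4 (ball4 c n) = (mu (ball1 0 n) ^+ 4)%E.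
Proof.
have m c' := measurable_ball1 c' n.
rewrite /ball4 product_measure1E//; last by repeat apply: measurableX.
rewrite /= product_measure1E//; last exact: measurableX.
rewrite /= product_measure1E//.
by rewrite !muleA; congr (_ * _ * _ * _)%E; exact: haar_ball1.
Qed.

Lemma measurable_compact_open (S : set V) : co S ->
  measurable (S : set (X * X * X * X)).
Proof.
move: S; apply: (compact_open_ind HF).
- exact: measurable0.
- by move=> S T _ _ _ mS mT; exact: measurableU.
- by move=> c n; rewrite -ball4E; exact: measurable_ball4.
Qed.

Lemma haar_compact_open_fin (S : set V) : co S -> mu4 S \is a fin_num.
Proof.
move: S; apply: (compact_open_ind HF).
- by rewrite measure0.
- move=> S T cS cT ST fS fT; rewrite measureU//; first by rewrite fin_numD fS.
  + exact: measurable_compact_open.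
  + exact: measurable_compact_open.
- by move=> c n; rewrite -ball4E haar_ball4 fin_numX// haar_ball1_fin.
Qed.

(** Invariance of the product measure is read off on balls, where it factors into invariance of
    [mu], and is then spread to compact open sets by induction. *)
Lemma haar_content : @content R F absF q (fun S : set V => fine (mu4 S)).
Proof.
have addU (S T : set V) : co S -> co T -> S `&` T = set0 ->
    fine (mu4 (S `|` T)) = fine (mu4 S) + fine (mu4 T).
  move=> cS cT ST; rewrite measureU//.
  + by apply: fineD; exact: haar_compact_open_fin.
  + exact: measurable_compact_open.
  + exact: measurable_compact_open.
split => // S u; move: S; apply: (compact_open_ind HF).
- by [].
- move=> S T cS cT ST IS IT.
  rewrite addU// -IS -IT -addU//.
  + exact: (compact_open_shift HF).
  + exact: (compact_open_shift HF).
  + apply: eq_setP => v; split => // -[h1 h2].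
    have : (S `&` T) (v - u) by [].
    by rewrite ST.
- move=> c n.
  rewrite (_ : [set v | _ (v - u)] = [set v | nrm (v - (c + u)) <= qz (- n%:Z)]).
    by rewrite -!ball4E !haar_ball4.
  by apply: eq_setP => v /=; rewrite opprD addrA addrAC.
Qed.

End HaarContent.

(** * Integrals of countably valued functions *)

Section CountablyValued.
Context {d : measure_display} {T : measurableType d} {R : realType}.
Context {m : {measure set T -> \bar R}}.

(** The sums of [a j * y j] dominate those of [|g|], so [g] is integrable and countable additivity
    gives a convergent series. Extension by zero identifies the integral over [B] with the one over
    the union. *)
Lemma Rintegral_countably_valued (E : nat -> set T) (B : set T) (g : T -> R)
    (a x y : nat -> R) (l M : R) :
  (forall n, measurable (E n)) -> trivIset setT E ->
  \bigcup_n E n `<=` B -> (forall v, B v -> ~ (\bigcup_n E n) v -> g v = 0) ->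
  (forall n v, E n v -> g v = x n) -> (forall n, m (E n) = (a n)%:E) ->
  (forall n, `|x n| <= y n) -> (forall n, \sum_(0 <= j < n) a j * y j <= M) ->
  (fun n => \sum_(0 <= j < n) a j * x j) @ \oo --> l ->
  (\int[m]_(v in B) g v)%R = l.
Proof.
move=> mE tE EB g0 gE mEa xy bound lim.
have a0 n : 0 <= a n by rewrite -lee_fin -mEa measure_ge0.
have -> : (\int[m]_(v in B) g v)%R = (\int[m]_(v in \bigcup_n E n) g v)%R.
  rewrite Rintegral_mkcond [RHS]Rintegral_mkcond; congr (Rintegral _ _ _).
  apply/funext => v; rewrite /patch; case: ifPn => [|nB].
    rewrite inE => Bv; case: ifPn => // /negP; rewrite inE => h.
    exact: g0.
  case: ifPn => //; rewrite inE => /EB Bv.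
  by move: nB; rewrite notin_setE.
have mg : measurable_fun (\bigcup_n E n) (EFin \o g).
  apply/measurable_fun_bigcup => // n.
  apply: (eq_measurable_fun (cst (x n)%:E)); last exact: measurable_cst.
  by move=> v; rewrite inE => /gE /= ->.
have int_cst h z : (forall n v, E n v -> h v = (z n)%:E) ->
    forall n, (\int[m]_(v in E n) h v)%E = (a n * z n)%:E.
  move=> hz n; rewrite (eq_integral (cst (z n)%:E)); last first.
    by move=> v; rewrite inE => /hz ->.
  rewrite integral_cst//.
  by transitivity ((z n)%:E * (a n)%:E)%E; [congr (_ * _)%E | rewrite -EFinM mulrC].
have ig : m.-integrable (\bigcup_n E n) (EFin \o g).
  apply/integrableP; split => //.
  rewrite ge0_integral_bigcup//; last exact: measurableT_comp.
  have I1 n : (\int[m]_(v in E n) `|(EFin \o g) v|)%E = (a n * `|x n|)%:E.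
    by apply: (int_cst _ (fun n => `|x n|)) => k v /gE /= ->.
  under eq_eseriesr do rewrite I1.
  apply: le_lt_trans (ltry M); apply: lime_le.
    by apply: is_cvg_nneseries => n _ _; rewrite lee_fin mulr_ge0.
  apply: nearW => n; rewrite sumEFin lee_fin; apply: le_trans (bound n).
  by apply: ler_sum => j _; rewrite ler_wpM2l.
have I2 n : (\int[m]_(v in E n) (EFin \o g) v)%E = (a n * x n)%:E.
  by apply: int_cst => k v /gE /= ->.
rewrite /Rintegral integral_bigcup//.
under eq_eseriesr do rewrite I2.
rewrite (_ : (fun n => _) = EFin \o (fun n => \sum_(0 <= j < n) a j * x j)).
  have E_lim : (EFin \o (fun n => \sum_(0 <= j < n) a j * x j)) @ \oo --> l%:E.
    by apply: cvg_EFin => //; exact: nearW.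
  by rewrite (cvg_lim _ E_lim).
by apply/funext => n /=; rewrite sumEFin.
Qed.

End CountablyValued.

(** * The complex exponential and its derivative *)

Section ComplexExponential.
Context {R : realType}.
Local Notation C := (R[i]^o)%type.
Local Notation Re := (@complex.Re R).
Local Notation Im := (@complex.Im R).

Lemma cexpD (z w : C) : cexp (z + w) = cexp z * cexp w.
Proof.
case: z w => [a b] [c e]; rewrite /cexp /=.
by apply/eqP; rewrite eq_complex /= expRD cosD sinD; apply/andP; split; apply/eqP; ring.
Qed.

Lemma cexp0 : cexp (0 : C) = 1.
Proof. by rewrite /cexp /= expR0 cos0 sin0 mulr1 mulr0. Qed.

Lemma cexp_neq0 (z : C) : cexp z != 0.
Proof.
apply/eqP => e; have := cexpD z (- z); rewrite e mul0r subrr cexp0 => /eqP.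
by rewrite oner_eq0.
Qed.

Lemma cexpN (z : C) : cexp (- z) = (cexp z)^-1.
Proof.
by apply: (mulfI (cexp_neq0 z)); rewrite -cexpD subrr cexp0 divff// cexp_neq0.
Qed.

Lemma cexp_real (x : R) : cexp (x%:C%C : C) = (expR x)%:C%C.
Proof. by rewrite /cexp /= cos0 sin0 mulr1 mulr0. Qed.

Lemma real_part_bound (z : C) (e : R) : `|z| < e%:C%C ->
  `|Re z| < e /\ `|Im z| < e.
Proof.
move=> h; split; rewrite -ltcR; apply: le_lt_trans h.
  exact: normc_ge_Re.
have := normc_ge_Re (z * 'i%C); rewrite ReiNIm normrN.
by rewrite normrM (_ : `|'i%C| = 1) ?mulr1// normc_def /= expr0n expr1n add0r sqrtr1.
Qed.

Lemma norm_complex_le (a b : R) : `|Complex a b : C| <= (`|a| + `|b|)%:C%C.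
Proof.
rewrite normc_def lecR /= -[leRHS]ger0_norm ?addr_ge0// -sqrtr_sqr.
apply: ler_wsqrtr; rewrite -(real_normK (num_real a)) -(real_normK (num_real b)).
have := normr_ge0 a; have := normr_ge0 b; nra.
Qed.

Lemma first_order (f : R -> R) (f' : R) (e : R) : is_derive (0 : R) (1 : R) f f' -> 0 < e ->
  exists2 d : R, 0 < d & forall x, `|x| < d -> `|f x - f 0 - f' * x| <= e * `|x|.
Proof.
move=> df e0.
have [dv dE] := df.
have : (fun h : R => h^-1 *: (f (h *: (1 : R) + 0) - f 0)) @ 0^' --> f'.
  by rewrite -dE; exact: dv.
move=> /cvgrPdist_le/(_ e e0)[d /= d0 hd]; exists d => // x xd.
have [->|x0] := eqVneq x 0; first by rewrite subrr mulr0 subrr normr0 mulr0.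
have := hd x; rewrite /ball_ /= sub0r normrN => /(_ xd x0).
rewrite addr0 [_ *: 1]mulr1 => h.
have -> : f x - f 0 - f' * x = - ((f' - x^-1 * (f x - f 0)) * x).
  by field.
by rewrite normrN normrM ler_wpM2r.
Qed.

Lemma cexp_first_order (e : R) : 0 < e -> exists2 d : R, 0 < d &
  forall z : C, `|z| < d%:C%C -> `|cexp z - 1 - z| <= e%:C%C * `|z|.
Proof.
move=> e0.
(* The eighth: the real and imaginary errors below amount to 3 and 5 times [e' * n]. *)
have [e' [e'0 e'e e'1]] : exists e', [/\ 0 < e', e' <= e / 8 & e' <= 1].
  exists (Num.min (e / 8) 1).
  by rewrite lt_min ltr01 divr_gt0// !ge_min !lexx orbT.
have [d1 d10 h1] := first_order (is_derive_expR 0) e'0.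
have [d2 d20 h2] := first_order (is_derive_cos 0) e'0.
have [d3 d30 h3] := first_order (is_derive_sin 0) e'0.
exists (Num.min (Num.min d1 d2) (Num.min d3 e')); first by rewrite !lt_min d10 d20 d30.
case=> x y hz; have [hx hy] := real_part_bound hz.
move: hx hy; rewrite /= !lt_min => /andP[/andP[x1 _] /andP[_ xe]].
move=> /andP[/andP[_ y2] /andP[y3 ye]].
move: (h1 x x1) (h2 y y2) (h3 y y3).
rewrite expR0 cos0 sin0 oppr0 mul0r mul1r !subr0 addr0 mul1r => k1 k2 k3.
have [n hn] : exists n : R, `|Complex x y : C| = n%:C%C.
  by rewrite normc_def; eexists.
have xn : `|x| <= n by rewrite -lecR -hn; exact: (normc_ge_Re (Complex x y)).
have yn : `|y| <= n.
  rewrite -lecR -hn; have := normc_ge_Re ((Complex x y : C) * 'i%C).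
  rewrite ReiNIm normrN normrM (_ : `|'i%C| = 1) ?mulr1//.
  by rewrite normc_def /= expr0n expr1n add0r sqrtr1.
rewrite hn -rmorphM /=.
have -> : cexp (Complex x y : C) - 1 - Complex x y =
    Complex (expR x * cos y - 1 - x) (expR x * sin y - y).
  by apply/eqP; rewrite eq_complex /= subr0 !eqxx.
apply: le_trans (norm_complex_le _ _) _; rewrite lecR.
have cos1 := cos_max y; have n0 : 0 <= n := le_trans (normr_ge0 x) xn.
have re_le : `|expR x * cos y - 1 - x| <= e' * n + 2 * (e' * n).
  have -> : expR x * cos y - 1 - x = (expR x - 1 - x) * cos y + (1 + x) * (cos y - 1).
    by ring.
  apply: le_trans (ler_normD _ _) _; rewrite !normrM; apply: lerD.
    rewrite -[leRHS]mulr1 ler_pM//; apply: le_trans k1 _.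
    by rewrite ler_wpM2l// ltW.
  rewrite ler_pM//.
    by apply: le_trans (ler_normD _ _) _; rewrite normr1; have := ltW xe; lra.
  by apply: le_trans k2 _; rewrite ler_wpM2l// ltW.
have exp1 : `|expR x - 1| <= 2 * `|x|.
  have -> : expR x - 1 = (expR x - 1 - x) + x by ring.
  apply: le_trans (ler_normD _ _) _.
  have : e' * `|x| <= `|x| by rewrite ler_piMl.
  lra.
have im_le : `|expR x * sin y - y| <= 3 * (e' * n) + 2 * e' * n.
  have -> : expR x * sin y - y = expR x * (sin y - y) + (expR x - 1) * y by ring.
  apply: le_trans (ler_normD _ _) _; rewrite !normrM; apply: lerD.
    have exp3 : `|expR x| <= 3.
      have -> : `|expR x| = `|(expR x - 1) + 1| by rewrite subrK.
      by apply: le_trans (ler_normD _ _) _; rewrite normr1; have := ltW xe; lra.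
    apply: ler_pM => //; apply: le_trans k3 _.
    by rewrite ler_wpM2l// ltW.
  rewrite ler_pM//; apply: le_trans exp1 _.
  by rewrite ler_wpM2l// ltW.
have : e' * n <= e / 8 * n by rewrite ler_wpM2r.
move: re_le im_le; lra.
Qed.

(** The functional equation carries the first order estimate at 0 over to [z]. *)
Lemma derivable_cexp (z : C) : derivable (@cexp R : C -> C) z 1.
Proof.
apply/cvg_ex; exists (cexp z); apply/cvgrPdist_le => e e0.
have eE : e = (Re e)%:C%C by rewrite RRe_real// gtr0_real.
have re0 : 0 < Re e by rewrite -ltcR -eE.
have [N hN] : exists N : R, `|cexp z| = N%:C%C by rewrite normc_def; eexists.
have N0 : 0 < N by rewrite -ltcR -hN normr_gt0 cexp_neq0.
have [d d0 hd] := cexp_first_order (divr_gt0 re0 N0).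
exists d%:C%C; first by rewrite /= ltcR.
move=> h /=; rewrite sub0r normrN => hhd h0.
have -> : cexp z - h^-1 *: (cexp (h *: (1 : C) + z) - cexp z)
    = cexp z * (- h^-1 * (cexp h - 1 - h)).
  rewrite [h *: 1]mulr1 cexpD [_ *: _]/(_ * _).
  have aux (K : fieldType) (u v k : K) : k != 0 ->
      v - k^-1 * (u * v - v) = v * (- k^-1 * (u - 1 - k)) by move=> k0; field.
  by have := aux R[i] (cexp h) (cexp z) h h0; apply.
rewrite normrM normrM normrN normfV hN.
have hn0 : 0 < `|h| by rewrite normr_gt0.
apply: le_trans (_ : N%:C%C * (`|h|^-1 * ((Re e / N)%:C%C * `|h|)) <= _).
  apply: ler_wpM2l; first by rewrite lecR ltW.
  by apply: ler_wpM2l; [rewrite invr_ge0 ltW | exact: hd].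
have -> : N%:C%C * (`|h|^-1 * ((Re e / N)%:C%C * `|h|)) = N%:C%C * (Re e / N)%:C%C.
  by rewrite [_%:C%C * `|h|]mulrC mulKf// gt_eqF.
by rewrite -rmorphM /= mulrC divfK ?gt_eqF// -eE.
Qed.

Lemma derivable_cexp_affine (a b z : C) :
  derivable (fun s : C => cexp (a * s + b) : C) z 1.
Proof.
apply/derivable1_diffP; apply: (@differentiable_comp _ _ _ _ (fun s : C => a * s + b : C) (@cexp R : C -> C)).
  by apply: differentiableD => //; apply: differentiableM.
by apply/derivable1_diffP; exact: derivable_cexp.
Qed.

Lemma holomorphic_near_neq0 (h : C -> C) (z : C) :
  (forall s : C, derivable h s 1) -> h z != 0 -> \forall s \near z, h s != 0.
Proof.
move=> dh hz.
have /differentiable_continuous hc : differentiable h z.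
  by apply/derivable1_diffP; exact: dh.
have hz0 : 0 < `|h z| by rewrite normr_gt0.
move/cvgrPdist_lt: hc => /(_ _ hz0).
apply: filterS => s /=; apply: contraTneq => ->.
by rewrite subr0 ltxx.
Qed.

(** The imaginary part is below 1, hence below [pi], so its sine vanishes only at 0. This isolates
    the zeros of the denominator of the continuation. *)
Lemma cexp_eq1_isolated (z : C) : `|z| < 1 -> cexp z = 1 -> z = 0.
Proof.
move=> z1; have [x1 y1] := real_part_bound (e := 1) z1.
case: z z1 x1 y1 => x y /= _ x1 y1 [e1 e2].
have sy : sin y = 0.
  by apply/eqP; move/eqP: e2; rewrite mulf_eq0 gt_eqF ?expR_gt0.
have pi1 : 1 < pi :> R by apply: lt_le_trans (pi_ge2 R); rewrite ltr1n.
have y0 : y = 0.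
  have [yneg|ypos|//] := ltgtP y 0.
    have : 0 < sin (- y) by apply: sin_gt0_pi; move: y1; rewrite ltr_norml; lra.
    by rewrite sinN sy oppr0 ltxx.
  have : 0 < sin y by apply: sin_gt0_pi; move: y1; rewrite ltr_norml; lra.
  by rewrite sy ltxx.
have : expR x = expR 0 by rewrite expR0 -[RHS]e1 y0 cos0 mulr1.
by move=> /expR_inj ->; rewrite y0.
Qed.

End ComplexExponential.

(** Summation by parts. When [b j] is proportional to T^j, [u] is q / T; the condition at index 0
    removes the lower boundary term. *)
Lemma geometric_telescope (K : comPzRingType) (a b : nat -> K) (q u : K) :
  (forall j, u * b j.+1 = q * b j) -> a 0%N = 0 -> forall n : nat,
  (1 - u) * (\sum_(0 <= j < n) a j * b j) =
    \sum_(0 <= j < n) (a j - q * a j.+1) * b j + u * (a n * b n).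
Proof.
move=> hb a0; elim=> [|n IH]; first by rewrite !big_geq// a0; ring.
rewrite !big_nat_recr//= mulrDr IH.
have -> : u * (a n.+1 * b n.+1) = a n.+1 * (q * b n) by rewrite -hb; ring.
by ring.
Qed.

(** * Complex integrals with a geometric tail *)

Section CountablySummed.
Context {d : measure_display} {T : measurableType d} {R : realType}.
Context {m : {measure set T -> \bar R}}.
Local Notation C := (R[i]^o)%type.
Local Notation Re := (@complex.Re R).
Local Notation Im := (@complex.Im R).

(** Here [v] stands for the modulus of [u] and [y] for that of [b], so [1 < v] is the condition of
    convergence. The telescoping is used twice: over the reals with [y] to get integrability, and
    over the complex numbers with [b] to get the value. *)
Lemma cintegral_geometric (E : nat -> set T) (B : set T) (f : T -> C)
    (a y : nat -> R) (b : nat -> C) (N : nat) (q v : R) (u : C) :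
  (forall n, measurable (E n)) -> trivIset setT E ->
  \bigcup_n E n `<=` B -> (forall x, B x -> ~ (\bigcup_n E n) x -> f x = 0) ->
  (forall n x, E n x -> f x = b n) -> (forall n, m (E n) = (a n)%:E) ->
  a 0%N = 0 -> (forall n, (N <= n)%N -> a n = q * a n.+1) ->
  0 < q -> 1 < v -> 1 - u != 0 ->
  (forall n, 0 <= y n) ->
  (forall n, `|Re (b n)| <= y n) -> (forall n, `|Im (b n)| <= y n) ->
  (forall n, v * y n.+1 = q * y n) -> (forall n, u * b n.+1 = q%:C%C * b n) ->
  cintegral m B f =
    (\sum_(0 <= j < N) (a j - q * a j.+1)%:C%C * b j) / (1 - u).
Proof.
move=> mE tE EB f0 fE mEa a00 tail q0 v1 u1 y0 Rb Ib vy ub.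
have a0 n : 0 <= a n by rewrite -lee_fin -mEa measure_ge0.
have v0 : 0 < v by apply: lt_trans v1.
have vn0 : v != 0 by rewrite gt_eqF.
have cut (K : comPzRingType) (a' b' : nat -> K) (q' : K) (n : nat) :
    (forall k, (N <= k)%N -> a' k = q' * a' k.+1) -> (N <= n)%N ->
    \sum_(0 <= j < n) (a' j - q' * a' j.+1) * b' j =
    \sum_(0 <= j < N) (a' j - q' * a' j.+1) * b' j.
  move=> h Nn; rewrite (big_cat_nat _ (n := N))//= [X in _ + X](_ : _ = 0) ?addr0//.
  rewrite big_nat_cond big1// => k /andP[/andP[Nk _] _].
  by rewrite -h// subrr mul0r.
pose S n := \sum_(0 <= j < n) a j * y j.
(* As [1 - v] is negative, dropping the nonnegative boundary term bounds the partial sums from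
   above. Passing to [maxn n N] makes the telescoped sum independent of the length. *)
have S_le n : S n <= (\sum_(0 <= j < N) (a j - q * a j.+1) * y j) / (1 - v).
  apply: le_trans (_ : S (maxn n N) <= _).
    rewrite /S (big_cat_nat _ (n := n) (p := maxn n N)) ?leq_maxl//= lerDl.
    by apply: sumr_ge0 => j _; rewrite mulr_ge0.
  rewrite ler_ndivlMr ?subr_lt0// mulrC (geometric_telescope vy a00).
  rewrite (cut _ a y q)// ?leq_maxr// lerDl.
  by rewrite !mulr_ge0// ltW.
(* Beyond [N], each step divides [a] by [q] and multiplies [y] by [q / v]. *)
have ay0 : (fun n => a n * y n) @ \oo --> (0 : R).
  rewrite -(cvg_shiftn N) /=.
  have -> : (fun n => a (n + N)%N * y (n + N)%N) =
      (fun n => a N * y N * v^-1 ^+ n).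
    apply/funext; elim=> [|n IH]; first by rewrite add0n expr0 mulr1.
    rewrite exprSr mulrA -IH addSn; apply: (mulfI vn0).
    rewrite mulrCA vy (tail (n + N)%N) ?leq_addl//.
    by field.
  have v_lt1 : `|v^-1| < 1 by rewrite ger0_norm ?invr_ge0 ?(ltW v0)// invf_lt1.
  have lim := cvgM (cvg_cst (a N * y N)) (cvg_expr v_lt1).
  by rewrite mulr0 in lim; exact: lim.
pose P n : C := \sum_(0 <= j < n) (a j)%:C%C * b j.
pose L : C := (\sum_(0 <= j < N) (a j - q * a j.+1)%:C%C * b j) / (1 - u).
have PL n : (N <= n)%N -> P n = L + u / (1 - u) * ((a n)%:C%C * b n).
  move=> Nn; apply: (mulfI u1).
  rewrite /P (geometric_telescope (a := fun n => (a n)%:C%C) ub); last by rewrite a00.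
  rewrite (cut R[i] (fun n => (a n)%:C%C) b q%:C%C)//; last first.
    by move=> k Nk; rewrite (tail k)// rmorphM.
  have aux (K : fieldType) (w s t x : K) : w != 0 ->
      w * (s / w + t / w * x) = s + t * x by move=> w0; field.
  rewrite [RHS](aux R[i])//; congr (_ + _).
  by apply: eq_bigr => j _; rewrite rmorphB rmorphM.
(* The real and the imaginary part are treated together as real linear functionals. *)
have part (phi : C -> R) : (forall z w, phi (z + w) = phi z + phi w) ->
    (forall (r : R) z, phi (r%:C%C * z) = r * phi z) ->
    (forall z, `|phi z| <= `|Re z| + `|Im z|) -> (forall n, `|phi (b n)| <= y n) ->
    (\int[m]_(x in B) phi (f x))%R = phi L.
  move=> phiD phiZ phi_le phib.
  have phi0 : phi 0 = 0 by apply: (addrI (phi 0)); rewrite -phiD !addr0.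
  apply: (@Rintegral_countably_valued _ _ _ _ E B _ a (fun n => phi (b n)) y _ _
    mE tE EB) S_le _ => //.
  - by move=> x Bx nEx; rewrite f0.
  - by move=> n x /fE ->.
  have -> : (fun n => \sum_(0 <= j < n) a j * phi (b j)) = (fun n => phi (P n)).
    apply/funext => n; rewrite /P; elim: n => [|n IH]; first by rewrite !big_geq.
    by rewrite !big_nat_recr//= IH phiD phiZ.
  apply/cvgrPdist_le => e e0; have [c cE] : exists c : C, u / (1 - u) = c by eexists.
  pose k := 2 * (`|Re c| + `|Im c|) + 1.
  have k0 : 0 < k by rewrite ltr_wpDl// mulr_ge0// addr_ge0.
  have ek : 0 < e / k by rewrite divr_gt0.
  move/cvgrPdist_le: ay0 => /(_ _ ek) => near_ay.
  near=> n.
  have Nn : (N <= n)%N by near: n; exact: nbhs_infty_ge.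
  rewrite (PL n Nn) phiD opprD addrA subrr sub0r normrN cE.
  rewrite mulrCA phiZ normrM (ger0_norm (a0 n)).
  have an : a n * y n <= e / k.
    have : `|0 - a n * y n| <= e / k by near: n.
    by rewrite sub0r normrN ger0_norm// mulr_ge0.
  apply: le_trans (_ : a n * (k * y n) <= _); last first.
    by rewrite mulrCA -ler_pdivlMl// [leRHS]mulrC.
  apply: ler_wpM2l => //; apply: le_trans (phi_le _) _.
  have ReM (z w : C) : Re (z * w) = Re z * Re w - Im z * Im w by case: z w => [? ?] [].
  have ImM (z w : C) : Im (z * w) = Re z * Im w + Im z * Re w by case: z w => [? ?] [].
  rewrite ReM ImM.
  apply: le_trans (_ : (`|Re c| * y n + `|Im c| * y n) + (`|Re c| * y n + `|Im c| * y n) <= _).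
    apply: lerD; [apply: le_trans (ler_normB _ _) _ | apply: le_trans (ler_normD _ _) _];
      rewrite !normrM; apply: lerD; rewrite ler_wpM2l//.
  have -> : (`|Re c| * y n + `|Im c| * y n) + (`|Re c| * y n + `|Im c| * y n) =
      (k - 1) * y n by rewrite /k addrK; ring.
  by rewrite ler_wpM2r// gerBl.
rewrite /cintegral (part Re) //.
- rewrite (part Im) //; first by rewrite -/L; case: (L).
  + by case=> [? ?] [].
  + by move=> r [z1 z2]; rewrite /= mul0r addr0.
  + by move=> z; rewrite lerDr.
- by case=> [? ?] [].
- by move=> r [z1 z2]; rewrite /= mul0r subr0.
- by move=> z; rewrite lerDl.
Unshelve. all: by end_near.
Qed.

End CountablySummed.

(** * Meromorphy of quotients of exponential sums *)

Section Continuation.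
Context {R : realType}.
Local Notation C := (R[i]^o)%type.
Local Notation Re := (@complex.Re R).

Lemma cexp_eq1_Re (z : C) : cexp z = 1 -> Re z = 0.
Proof.
case: z => x y [e1 e2] /=; apply: expR_inj; rewrite expR0.
apply/eqP; rewrite -(@eqrXn2 _ 2) ?expR_ge0// expr1n.
by apply/eqP; rewrite -[LHS]mulr1 -(cos2Dsin2 y) mulrDr -!exprMn e1 e2 expr1n expr0n /= addr0 cos2Dsin2.
Qed.

Lemma derivable_one_sub_cexp (al be s : C) :
  derivable (fun s : C => 1 - cexp (al * s + be) : C) s 1.
Proof.
have d2 := @derivable_cexp_affine R al be s.
have d1 : derivable (cst 1 : C -> C) s 1 by exact: derivable_cst.
exact: (derivableB d1 d2).
Qed.

Lemma derivable_div (g h : C -> C) (s : C) : h s != 0 ->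
  derivable g s 1 -> derivable h s 1 -> derivable (fun s : C => g s / h s : C) s 1.
Proof.
move=> hs dg dh.
have dV := @derivableV R[i] C h s 1 hs dh.
exact: (derivableM dg dV).
Qed.

(** Two zeros [s] and [p] of the denominator give [cexp (al * (s - p)) = 1], so within distance
    [|al|^-1] of a zero there is no other. *)
Lemma meromorphic_quotient (g : C -> C) (al be : C) : al != 0 ->
  (forall s, derivable g s 1) ->
  meromorphic (fun s => g s / (1 - cexp (al * s + be))).
Proof.
move=> al0 dg p; exists g, (fun s => 1 - cexp (al * s + be)).
have dh s : derivable (fun s : C => 1 - cexp (al * s + be) : C) s 1.
  exact: derivable_one_sub_cexp.
split.
- exists 1; first exact: ltr01.
  by move=> s _; exact: dg.
- exists 1; first exact: ltr01.
  by move=> s _; exact: dh.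
have [h0|h0] := eqVneq (1 - cexp (al * p + be)) 0; last first.
  have [e /= e0 he] := holomorphic_near_neq0 dh h0.
  by exists e => //= s hs _; split => //; exact: he.
have hp : cexp (al * p + be) = 1 by apply/esym/eqP; rewrite -subr_eq0; apply/eqP.
have a0 : 0 < `|al|^-1 by rewrite invr_gt0 normr_gt0.
exists `|al|^-1 => //= s; rewrite /ball_ /= => hs sp; split => //.
rewrite subr_eq0 eq_sym; apply/eqP => hs1.
have : cexp (al * (s - p)) = 1.
  have -> : al * (s - p) = (al * s + be) + - (al * p + be) by ring.
  by rewrite cexpD cexpN hs1 hp invr1 mulr1.
move=> /cexp_eq1_isolated H; move: sp; rewrite -subr_eq0.
have /eqP : al * (s - p) = 0.
  apply: H; rewrite normrM -ltr_pdivlMl ?normr_gt0// mulr1.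
  by rewrite -normrN opprB.
by rewrite mulf_eq0 (negPf al0) /= => ->.
Qed.

Lemma holomorphic_quotient (g : C -> C) (al be : C) (p : C) :
  1 - cexp (al * p + be) != 0 -> (forall s, derivable g s 1) ->
  holomorphic_at (fun s => g s / (1 - cexp (al * s + be))) p.
Proof.
move=> h0 dg.
have dh s : derivable (fun s : C => 1 - cexp (al * s + be) : C) s 1.
  exact: derivable_one_sub_cexp.
have [e /= e0 he] := holomorphic_near_neq0 dh h0.
exists e => //= s /he hs.
exact: (derivable_div (h := fun s : C => 1 - cexp (al * s + be) : C) hs (dg s) (dh s)).
Qed.

Lemma derivable_exp_sum (I : Type) (t : seq I) (c al be : I -> C) (z : C) :
  derivable (fun s : C => \sum_(i <- t) c i * cexp (al i * s + be i) : C) z 1.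
Proof.
elim: t => [|i t IH].
  rewrite (_ : (fun s => _) = cst 0); first exact: derivable_cst.
  by apply/funext => s; rewrite big_nil.
rewrite (_ : (fun s => _) = (fun s : C => c i * cexp (al i * s + be i) : C) +
    (fun s : C => \sum_(i <- t) c i * cexp (al i * s + be i) : C)).
  have d2 := @derivable_cexp_affine R (al i) (be i) z.
  have d1 : derivable (cst (c i) : C -> C) z 1 by exact: derivable_cst.
  exact: (derivableD (derivableM d1 d2) IH).
by apply/funext => s; rewrite big_cons.
Qed.

End Continuation.

Section ExponentBounds.
Context {R : realType}.
Local Notation C := (R[i]^o)%type.

Lemma Re_cexp_le (z : C) : `|complex.Re (cexp z)| <= expR (complex.Re z).
Proof.
by rewrite /= normrM ger0_norm ?expR_ge0// ler_piMr ?expR_ge0// cos_max.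
Qed.

Lemma Im_cexp_le (z : C) : `|complex.Im (cexp z)| <= expR (complex.Re z).
Proof.
by rewrite /= normrM ger0_norm ?expR_ge0// ler_piMr ?expR_ge0// sin_max.
Qed.

Lemma Re_real_affine (a b : R) (s : C) :
  complex.Re (a%:C%C * s + b%:C%C) = a * complex.Re s + b.
Proof. by case: s => x y; rewrite /= mul0r subr0. Qed.

End ExponentBounds.

(** * The integral as a rational function and its value at 0 *)

Theorem mainTheorem2 (R : realType) (F : fieldType) (absF : F -> R) (q p : nat)
    (F_local : local_field absF q)
    (p_char : residual_char absF p) (p_odd : odd p)
    (mu : {sigma_finite_measure set (borelF absF) -> \bar R})
    (mu_haar : is_normalized_haar mu)
    (A D r : F) (A_neq0 : A != 0) (D_neq0 : D != 0) (r_neq0 : r != 0)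
    (A_nsq : ~ is_square A) (D_nsq : ~ is_square D)
    (AD_nsq : ~ is_square (A * D)) :
  exists M : R[i]^o -> R[i]^o,
    [/\ meromorphic M,
        forall s : R[i]^o, 2^-1 < complex.Re s -> M s = I_ q mu s r A D,
        holomorphic_at M 0
      & M 0 = 0].
Proof.
have HF := F_local.
pose nu (S : set (F * F * F * F)) := fine ((mu \x mu \x mu \x mu)%E S).
have Hnu : @content R F absF q nu := haar_content HF mu_haar.
have [c [c0 [coS [K [fullS tailS sumS]]]]] :=
  quadric_levels HF p_char p_odd Hnu A_neq0 D_neq0 r_neq0 A_nsq.
pose S (k : int) := [set v : F * F * F * F | @nrm R F absF v = 1 /\
  absF (quadric r A D v) <= absF c * (q%:R ^ (- k) : R)].
pose N k := nu (S k) - nu (S (k + 1)).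
have tailN (k : int) : K%:Z <= k -> N k = q%:R * N (k + 1) by exact: tailS.
have sumN : \sum_(k <- window K) (N k - q%:R * N (k + 1)) * q%:R ^ (k + k) = 0.
  exact: sumS.
clear tailS sumS.
(* The shell where the quadric has absolute value [val n]; the shift by [K] indexes all nonempty
   shells by natural numbers, and [a n] is the volume. *)
pose E (n : nat) := S (n%:Z - K%:Z) `\` S (n%:Z - K%:Z + 1).
pose a (n : nat) := N (n%:Z - K%:Z).
pose la : R := ln q%:R.
have q0 : 0 < q%:R :> R := qR_gt0 HF.
have la0 : 0 < la by rewrite ln_gt0// (qR_gt1 HF).
have ela : expR la = q%:R by rewrite lnK// posrE.
have ka0 : 0 < absF c by rewrite (absF_gt0 HF).
pose val (n : nat) : R := absF c * q%:R ^ (K%:Z - n%:Z).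
have val0 n : 0 < val n by rewrite mulr_gt0// (qz_gt0 HF).
pose rho (n : nat) : R := ln (val n).
have rhoS n : rho n = rho n.+1 + la.
  rewrite /rho -lnM ?posrE//; congr (ln _); rewrite /val -mulrA; congr (_ * _).
  have -> : K%:Z - n%:Z = (K%:Z - n.+1%:Z) + 1 by lia.
  by rewrite (qzD HF) expr1z.
have aS n : a n.+1 = N (n%:Z - K%:Z + 1).
  by rewrite /a; congr N; lia.
have cSn k : @compact_open R F absF q (S k) by exact: coS.
have fullS' (k : int) : k <= 1 - K%:Z -> S k = [set v | @nrm R F absF v = 1].
  exact: fullS.
have scaled v : absF (quadric r A D v) = absF c * absF (quadric r A D v / c).
  by rewrite -(absFM HF) mulrC divfK.
have Eval n v : E n v -> absF (quadric r A D v) = val n.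
  move=> [[v1 le] nle]; rewrite scaled /val; congr (_ * _).
  move: le; rewrite scaled ler_pM2l// => le.
  apply/eqP; rewrite eq_le; apply/andP; split.
    by apply: le_trans le _; rewrite (ler_qz HF); lia.
  rewrite leNgt (absF_lt_qz HF); apply/negP => h; apply: nle; split => //.
  rewrite scaled ler_pM2l//; apply: le_trans h _; rewrite (ler_qz HF); lia.
have mE n : measurable (E n : set (borelF absF * borelF absF * borelF absF * borelF absF)).
  by apply: (measurable_compact_open HF); exact: (compact_openD HF).
have tE : trivIset setT E.
  apply/trivIsetP => i j _ _ ij; apply: eq_setP => v; split => // -[/Eval ei /Eval].
  rewrite ei /val => /(mulfI (lt0r_neq0 ka0))/(qz_inj HF) eij.
  by move/eqP: ij; apply; lia.
have UE v : @unit_vectors R F absF v <-> @nrm R F absF v = 1 by case: v => [[[x y] z] t].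
have EB : \bigcup_n E n `<=` @unit_vectors R F absF.
  by move=> v [n _ [[v1 _] _]]; apply/UE.
have outside v : @unit_vectors R F absF v -> ~ (\bigcup_n E n) v -> quadric r A D v = 0.
  move=> /UE v1 nE; apply/eqP/negPn/negP => Q0; apply: nE.
  have [m hm] := absF_discrete HF (mulf_neq0 Q0 (invr_neq0 c0)).
  (* Already the level [1 - K] is the whole sphere, so [m <= K - 1] and the shell index is a natural
     number. *)
  have : S (1 - K%:Z) v by rewrite fullS'.
  move=> [_]; rewrite scaled hm ler_pM2l// (ler_qz HF) => mK.
  exists (absz (K%:Z - m)) => //; split; first split => //.
    by rewrite scaled hm ler_pM2l// (ler_qz HF); lia.
  by move=> [_]; rewrite scaled hm ler_pM2l// (ler_qz HF); lia.
have mEa n : (mu \x mu \x mu \x mu)%E (E n) = (a n)%:E.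
  have -> : a n = nu (E n).
    rewrite /E (contentD HF Hnu)//.
    move=> v [v1 vle]; split => //; apply: le_trans vle _.
    by rewrite ler_pM2l// (ler_qz HF); lia.
  by rewrite fineK//; apply: (haar_compact_open_fin HF mu_haar); exact: (compact_openD HF).
(* The levels [- K] and [1 - K] both are the whole sphere, so the first shell is empty, as the
   telescoping requires. *)
have a00 : a 0%N = 0.
  by rewrite /a /N fullS'; [rewrite fullS' ?subrr//; lia | lia].
have atail n : (K + K <= n)%N -> a n = q%:R * a n.+1.
  by move=> hn; rewrite aS /a /N; apply: tailN; lia.
pose coef j : R[i] := (a j - q%:R * a j.+1)%:C%C.
pose ex j (s : R[i]^o) : R[i]^o := (2 * rho j)%:C%C * s + (- (2 * rho j))%:C%C.
pose c1 : R[i] := (1 - q%:R^-1)^-1.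
pose g (s : R[i]^o) : R[i]^o :=
  \sum_(j <- index_iota 0 (K + K)) (c1 * coef j) * cexp (ex j s).
have dg s : derivable g s 1 by exact: derivable_exp_sum.
(* With these constants [cexp (al * s + be)] is q^(2s - 1), that is q / T, which can equal 1 only on
   the line Re s = 1/2. *)
pose al : R[i]^o := (2 * la)%:C%C; pose be : R[i]^o := (- la)%:C%C.
have al0 : al != 0.
  by rewrite /al -(rmorph0 (real_complex R)) (inj_eq (@complexI R)) mulf_neq0// gt_eqF.
have h_neq0 (s : R[i]^o) : complex.Re s != 2^-1 -> 1 - cexp (al * s + be) != 0.
  move=> hs; rewrite subr_eq0 eq_sym; apply/eqP => /cexp_eq1_Re.
  rewrite Re_real_affine => e; move/eqP: hs; apply.
  have : la * (2 * complex.Re s - 1) = 0 by rewrite -[RHS]e; ring.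
  by move/eqP; rewrite mulf_eq0 (gt_eqF la0) /= => /eqP; lra.
have two (x : R) : (2 * x)%:C%C = 2 * x%:C%C :> R[i] by rewrite rmorphM rmorph_nat.
have toN (x : R) : (- x)%:C%C = - x%:C%C :> R[i] by rewrite rmorphN.
have toD (x y : R) : (x + y)%:C%C = x%:C%C + y%:C%C :> R[i] by rewrite rmorphD.
exists (fun s => g s / (1 - cexp (al * s + be))); split.
- exact: meromorphic_quotient.
- move=> s hs; rewrite /I_ /integral_V0.
  set x := complex.Re s in hs.
  rewrite (@cintegral_geometric _ _ _ _
    (E : nat -> set (borelF absF * borelF absF * borelF absF * borelF absF))
    (@unit_vectors R F absF) _ a
    (fun n => expR (2 * rho n * x - 2 * rho n)) (fun n => cexp (ex n s)) (K + K)
    q%:R (expR (2 * la * x - la)) (cexp (al * s + be))) //.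
  + rewrite mulrA; congr (_ / _); rewrite /g big_distrr /=.
    by apply: eq_bigr => j _; rewrite mulrA.
  (* On the zero set of the quadric the integrand is 0 by the convention in [cpow]. *)
  + by move=> v Bv nE; rewrite /cpow (outside v Bv nE) (absF0 HF) eqxx.
  + move=> n v /Eval Qv; rewrite /cpow Qv (gt_eqF (val0 n)) -/(rho n); congr cexp.
    rewrite /ex toN !two.
    have aux (T : comPzRingType) (z w : T) : 2 * (z - 1) * w = 2 * w * z - 2 * w.
      by ring.
    exact: (aux R[i]).
  + by rewrite expR_gt1; nra.
  + by apply: h_neq0; rewrite gt_eqF.
  + move=> n; apply: le_trans (Re_cexp_le _) _.
    by rewrite Re_real_affine.
  + move=> n; apply: le_trans (Im_cexp_le _) _.
    by rewrite Re_real_affine.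
  + move=> n; rewrite -ela -!expRD (rhoS n); congr expR; ring.
  + move=> n; rewrite -ela -cexp_real -!cexpD; congr cexp.
    rewrite /ex /al /be (rhoS n) !toN !two toD.
    have aux (T : comPzRingType) (z l w : T) :
        (2 * l * z + - l) + (2 * w * z + - (2 * w)) =
        l + (2 * (w + l) * z + - (2 * (w + l))) by ring.
    exact: (aux R[i]).
- apply: holomorphic_quotient => //; apply: h_neq0.
  by rewrite /= eq_sym invr_eq0 pnatr_eq0.
suff -> : g 0 = 0 by rewrite mul0r.
(* At s = 0 the integrand on shell [j] is |Q|^-2, and its power of [q] is the factor [k + k] with
   [k = j - K]. The numerator is thus a multiple of the vanishing window sum. *)
have exp0 j : cexp (ex j 0) =
    ((absF c)^-1 ^+ 2 * q%:R ^ ((j%:Z - K%:Z) + (j%:Z - K%:Z)))%:C%C.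
  rewrite /ex mulr0 add0r cexp_real; congr (_%:C)%C.
  rewrite mulr_natl mulr2n opprD expRD expRN lnK ?posrE// /val invfM.
  by rewrite invr_expz opprB (qzD HF); ring.
rewrite /g; under eq_bigr do rewrite exp0 /coef -mulrA -rmorphM.
rewrite -big_distrr /= -rmorph_sum.
rewrite (_ : \sum_(j <- _) _ = (absF c)^-1 ^+ 2 *
    \sum_(k <- window K) (N k - q%:R * N (k + 1)) * q%:R ^ (k + k)).
  by rewrite sumN mulr0 rmorph0 mulr0.
rewrite /window big_map /index_iota subn0 big_distrr /=.
by apply: eq_bigr => j _; rewrite aS /a; ring.
Qed.
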